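(* The $20$ three-element subsets of $\mathfrak{S}_3=\{123,132,213,231,312,321\}$ form exactly eleven shape-Wilf-equivalence classes. Namely, two three-element subsets $P,Q\subseteq \mathfrak{S}_3$ satisfy $P\sim_s Q$ if and only if they belong to the same class in the following list: \begin{itemize} \item Class I: $\{123,213,231\}$, $\{123,213,312\}$, $\{132,213,231\}$, $\{132,213,312\}$, $\{132,231,321\}$, $\{132,312,321\}$; \item Class II: $\{123,231,312\}$, $\{132,231,312\}$, $\{213,231,312\}$; \item Class III: $\{123,132,312\}$, $\{213,231,321\}$; \item Class IV: $\{123,132,231\}$, $\{213,312,321\}$; \item Class V: $\{123,132,213\}$; \item Class VI: $\{123,132,321\}$; \item Class VII: $\{123,213,321\}$; \item Class VIII: $\{123,231,321\}$; \item Class IX: $\{123,312,321\}$; \item Class X: $\{132,213,321\}$; \item Class XI: $\{231,312,321\}$. \end{itemize}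
   Context: A Ferrers board $F$ (with $n$ rows and $n$ columns) is drawn in French notation: a left-justified, bottom-justified array of cells whose row lengths weakly increase from top to bottom. A transversal of $F$ is a placement of $1$'s in cells of $F$ (all other cells contain $0$) such that every row and every column contains exactly one $1$. Columns are numbered from left to right and heights (rows) from bottom to top; a transversal is identified with the permutation $\pi=\pi_1\cdots\pi_n$, where $\pi_c$ is the height of the $1$ in column $c$. A transversal $T$ contains a pattern $p\in\mathfrak{S}_k$ if there are columns $c_1<\cdots<c_k$ such that $\pi_{c_1}\cdots\pi_{c_k}$ is order-isomorphic to $p$ and all $k^2$ cells at the intersections of these $k$ columns with the $k$ rows of these $1$'s lie in $F$; otherwise $T$ avoids $p$. For a set $P$ of patterns, $\mathfrak{S}_F(P)$ is the set of transversals of $F$ avoiding every pattern in $P$. Two pattern sets are shape-Wilf-equivalent, $P\sim_s Q$, if $|\mathfrak{S}_F(P)|=|\mathfrak{S}_F(Q)|$ for every Ferrers board $F$. *)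

(* Defs.v *)
From mathcomp Require Import all_boot all_fingroup.

Set Implicit Arguments.
Unset Strict Implicit.
Unset Printing Implicit Defensive.

(* A cell is a pair (column, height); columns are numbered from left to right
   and heights from bottom to top, both starting from 0.
   The four clauses: left-justified; bottom-justified with row lengths weakly
   increasing from top to bottom; none of the n rows is empty; none of the n
   columns is empty. *)
Definition ferrers_board (n : nat) (F : {set 'I_n * 'I_n}) : Prop :=
  [/\ forall c c' r : 'I_n, c' <= c -> (c, r) \in F -> (c', r) \in F,
      forall c r r' : 'I_n, r' <= r -> (c, r) \in F -> (c, r') \in F,
      forall r : 'I_n, exists c : 'I_n, (c, r) \in F
    & forall c : 'I_n, exists r : 'I_n, (c, r) \in F].

(* s c is the height of the 1 in column c. *)
Definition transversal (n : nat) (F : {set 'I_n * 'I_n}) (s : 'S_n) : bool :=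
  [forall c : 'I_n, (c, s c) \in F].

(* The columns of the occurrence are f 0 < f 1 < ... < f (k - 1). *)
Definition contains (n k : nat) (F : {set 'I_n * 'I_n}) (s : 'S_n) (p : 'S_k)
    : bool :=
  [exists f : {ffun 'I_k -> 'I_n},
    [&& [forall i : 'I_k, forall j : 'I_k, (i < j) ==> (f i < f j)],
        [forall i : 'I_k, forall j : 'I_k,
           (s (f i) < s (f j)) == (p i < p j)]
      & [forall i : 'I_k, forall j : 'I_k, (f i, s (f j)) \in F]]].

Definition avoiders (n k : nat) (F : {set 'I_n * 'I_n}) (P : {set 'S_k})
    : {set 'S_n} :=
  [set s : 'S_n | transversal F s & [forall p in P, ~~ contains F s p]].

Definition shape_wilf_equiv (k : nat) (P Q : {set 'S_k}) : Prop :=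
  forall (n : nat) (F : {set 'I_n * 'I_n}),
    ferrers_board F -> #|avoiders F P| = #|avoiders F Q|.

(* C is one of the classes of shape-Wilf equivalence restricted to the
   three-element subsets of S_3. *)
Definition shape_wilf_class (C : {set {set 'S_3}}) : Prop :=
  exists2 P : {set 'S_3}, #|P| = 3 &
    forall Q : {set 'S_3}, Q \in C <-> #|Q| = 3 /\ shape_wilf_equiv P Q.

(* One-line notation with values 1, ..., n, whereas 'I_n starts from 0. *)
Definition one_line (n : nat) (p : 'S_n) : seq nat :=
  [seq (p i : nat).+1 | i <- enum 'I_n].

Definition w123 : seq nat := [:: 1; 2; 3].
Definition w132 : seq nat := [:: 1; 3; 2].
Definition w213 : seq nat := [:: 2; 1; 3].
Definition w231 : seq nat := [:: 2; 3; 1].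
Definition w312 : seq nat := [:: 3; 1; 2].
Definition w321 : seq nat := [:: 3; 2; 1].

(* The set of the three permutations with one-line notations u, v and w. *)
Definition pats (u v w : seq nat) : {set 'S_3} :=
  [set p : 'S_3 | one_line p \in [:: u; v; w]].

Definition classI : {set {set 'S_3}} :=
  [set:: [:: pats w123 w213 w231; pats w123 w213 w312;
             pats w132 w213 w231; pats w132 w213 w312;
             pats w132 w231 w321; pats w132 w312 w321]].
Definition classII : {set {set 'S_3}} :=
  [set:: [:: pats w123 w231 w312; pats w132 w231 w312; pats w213 w231 w312]].
Definition classIII : {set {set 'S_3}} :=
  [set:: [:: pats w123 w132 w312; pats w213 w231 w321]].
Definition classIV : {set {set 'S_3}} :=
  [set:: [:: pats w123 w132 w231; pats w213 w312 w321]].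
Definition classV : {set {set 'S_3}} := [set pats w123 w132 w213].
Definition classVI : {set {set 'S_3}} := [set pats w123 w132 w321].
Definition classVII : {set {set 'S_3}} := [set pats w123 w213 w321].
Definition classVIII : {set {set 'S_3}} := [set pats w123 w231 w321].
Definition classIX : {set {set 'S_3}} := [set pats w123 w312 w321].
Definition classX : {set {set 'S_3}} := [set pats w132 w213 w321].
Definition classXI : {set {set 'S_3}} := [set pats w231 w312 w321].

Definition listed_classes : seq {set {set 'S_3}} :=
  [:: classI; classII; classIII; classIV; classV; classVI; classVII;
      classVIII; classIX; classX; classXI].

(* Main.v *)
Require Import Defs.
From mathcomp Require Import all_boot all_fingroup.
From mathcomp Require Import zify.

Set Implicit Arguments.
Unset Strict Implicit.
Unset Printing Implicit Defensive.

(** The counts are computed by deleting the top row of a board together with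
    the column that holds its 1.  The 1 of the top row, say in column c, must
    lie in one of the r columns of full height, and every occurrence of a
    pattern that uses it as its letter 3 lies in those r columns.  Whether such
    an occurrence exists depends only on how the other r - 1 full columns are
    cut at c: for instance 123 is excluded when the columns before c decrease,
    132 when no column before c is lower than one after c ([safe],
    [contains_lift]).  The board that remains is again given by row lengths, and
    it does not depend on c.  So the avoiders of a board are the words obtained by
    inserting successive maxima at permitted positions ([card_avoiders]), and
    their number depends only on the list of the numbers r ([profile]).

    For each triple the permitted positions are easy to describe.  Let G(k) be the
    number of avoiders whose first k columns, k at most r, have a certain shape
    (increasing, decreasing, or ending with their minimum, according to the
    triple; there is no condition for k at most 1), and let G' be the same number
    for the board with its top row deleted.  Then the permitted positions give

      - Class I: G(k) = G'(r - 1) for k at least 2, and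
        G(1) = G'(1) + G'(r - 1) if r is at least 2;
      - Class II: G(k) = G'(r - 1) + G'(k), without the second term if k = r;
      - Class III: G(k) = (r + 1 - k) G'(r - 1).

    Triples with the same recursion are equivalent ([wilf_recursion]).
    Reflecting boards in the diagonal replaces the patterns by their inverses,
    that is, exchanges 231 and 312; this turns Class III into Class IV and
    supplies the two triples of Class I that are not counted directly
    ([wilf_head]).  Conversely two boards with five rows already have different
    pairs of counts for triples in different classes ([signature_class]). *)

(** * Patterns as words *)

Definition patterns3 : seq (seq nat) := [:: w123; w132; w213; w231; w312; w321].

Lemma one_line_mem (p : 'S_3) : one_line p \in patterns3.
Proof.
have: one_line p \in permutations [:: 1; 2; 3].
  rewrite mem_permutations; apply: uniq_perm => //.
    by rewrite map_inj_uniq ?enum_uniq // => i j [/val_inj/perm_inj].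
  move=> k; apply/mapP/idP => [[i _ ->]|]; first by case: (p i) => [[|[|[|]]]].
  have H (m : 'I_3) : exists2 i, i \in enum 'I_3 & m.+1 = (p i).+1.
    by exists (p^-1%g m); rewrite ?mem_enum // permKV.
  rewrite !inE => /or3P[] /eqP->.
  - exact: (H (@Ordinal 3 0 isT)).
  - exact: (H (@Ordinal 3 1 isT)).
  - exact: (H (@Ordinal 3 2 isT)).
by apply: (allP (_ : all (mem patterns3) _)); vm_compute.
Qed.

Lemma one_line_inj : injective (@one_line 3).
Proof.
move=> p q /eq_in_map pq; apply/permP => i; apply: val_inj.
by case: (pq i (mem_enum _ i)).
Qed.

Lemma one_line_surj w : w \in patterns3 -> exists p : 'S_3, one_line p = w.
Proof.
have u6 : uniq [seq one_line p | p : 'S_3].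
  by rewrite map_inj_uniq ?enum_uniq //; apply: one_line_inj.
have [||_ eq6] := uniq_min_size u6 (s2 := patterns3).
- by move=> w' /mapP[p _ ->]; apply: one_line_mem.
- by rewrite size_map -cardE card_Sn.
by rewrite -eq6 => /mapP[p _ ->]; exists p.
Qed.

(** * Boards given by their row lengths *)

Definition board n (ell : nat -> nat) : {set 'I_n * 'I_n} :=
  [set x : 'I_n * 'I_n | x.1 < ell x.2].

Definition antitone (ell : nat -> nat) := {homo ell : i j / i <= j >-> j <= i}.

(** Quantifying over the rows above i as well makes the row lengths antitone for
    every set of cells and every i; on a Ferrers board it changes nothing. *)
Definition row_len n (F : {set 'I_n * 'I_n}) (i : nat) : nat :=
  #|[set c : 'I_n | [exists r : 'I_n, (i <= r) && ((c, r) \in F)]]|.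

Lemma card_ord_lt n c : c <= n -> #|[set i : 'I_n | i < c]| = c.
Proof.
move=> cn; rewrite -sum1dep_card.
by rewrite -(big_ord_widen n (fun=> 1) cn) sum1_card card_ord.
Qed.

Lemma down_closed_card n (S : {set 'I_n}) (c : 'I_n) :
  (forall i j : 'I_n, j <= i -> i \in S -> j \in S) -> (c \in S) = (c < #|S|).
Proof.
move=> downS; apply/idP/idP => [cS|].
  rewrite -[X in X <= _](card_ord_lt (ltn_ord c)).
  by apply/subset_leq_card/subsetP => j; rewrite inE ltnS => /downS; apply.
apply: contraTT => cS; rewrite -leqNgt -[X in _ <= X](card_ord_lt (ltnW (ltn_ord c))).
apply/subset_leq_card/subsetP => j jS; rewrite inE ltnNge.
by apply: contra cS => cj; apply: downS jS.
Qed.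

Lemma row_len_antitone n (F : {set 'I_n * 'I_n}) : antitone (row_len F).
Proof.
move=> i j ij; apply/subset_leq_card/subsetP => c; rewrite !inE => /existsP[r /andP[jr rF]].
by apply/existsP; exists r; rewrite rF (leq_trans ij).
Qed.

Lemma row_len_le n (F : {set 'I_n * 'I_n}) i : row_len F i <= n.
Proof. by rewrite -[X in _ <= X]card_ord max_card. Qed.

Lemma ferrers_boardE n (F : {set 'I_n * 'I_n}) :
  ferrers_board F -> F = board n (row_len F).
Proof.
case=> left_just bottom_just _ _; apply/setP => -[c r]; rewrite inE /=.
rewrite -down_closed_card => [|i j ji]; rewrite !inE.
  apply/idP/existsP => [crF|[r' /andP[rr' cF]]]; first by exists r; rewrite leqnn.
  exact: bottom_just cF.
case/existsP=> r' /andP[rr' iF]; apply/existsP; exists r'.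
by rewrite rr' (left_just i).
Qed.

Lemma board_ferrers n ell :
  antitone ell -> n <= ell 0 -> (0 < n -> 0 < ell n.-1) ->
  ferrers_board (board n ell).
Proof.
move=> anti ell0 elln; split => [c c' r|c r r'|r|c]; rewrite ?inE /=.
- exact: leq_ltn_trans.
- by move=> /anti/[swap]; apply: leq_trans.
- have n0 : 0 < n by apply: leq_ltn_trans (ltn_ord r).
  exists (Ordinal n0); rewrite inE /=; apply: leq_trans (elln n0) _.
  by apply: anti; have := ltn_ord r; lia.
- have n0 : 0 < n by apply: leq_ltn_trans (ltn_ord c).
  by exists (Ordinal n0); rewrite inE /=; apply: leq_trans ell0.
Qed.

(** * Deleting the top row *)

Definition clear (b : bool) : rel nat := fun i j => if b then j <= i else i < j.

(** Here x and y are the heights in the full columns before and after the 1 of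
    the top row, which can only be the letter 3 of an occurrence of w.  The other
    two letters of w occur in x and y as the position of 3 in w prescribes, and
    [index 1 w < index 2 w] tells whether they ascend. *)
Definition safe (w x y : seq nat) : bool :=
  let b := index 1 w < index 2 w in
  match index 3 w with
  | 0 => pairwise (clear b) y
  | 1 => allrel (clear b) x y
  | _ => pairwise (clear b) x
  end.

(** The positions i < j of two letters around a cut at c, when the letter 3
    inserted at the cut comes first, second or third among the three. *)
Definition zone (k c i j : nat) : bool :=
  match k with 0 => c <= i | 1 => i < c <= j | _ => j < c end.

Lemma clearE b i j : clear b i j = ((i < j) != b).
Proof. by rewrite /clear; case: b; case: ltnP. Qed.

Lemma pairwise_takeP (R : rel nat) c (u : seq nat) : c <= size u ->
  reflect (forall i j, i < j -> j < c -> R (nth 0 u i) (nth 0 u j))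
          (pairwise R (take c u)).
Proof.
move=> cu; apply: (iffP (pairwiseP 0)); rewrite !size_take_min (minn_idPl cu) => H i j.
  by move=> ij jc; have := H i j; rewrite !nth_take // ?inE; [apply | ]; lia.
by rewrite !inE => ic jc ij; rewrite !nth_take //; apply: H.
Qed.

Lemma pairwise_dropP (R : rel nat) c (u : seq nat) :
  reflect (forall i j, c <= i -> i < j -> j < size u -> R (nth 0 u i) (nth 0 u j))
          (pairwise R (drop c u)).
Proof.
apply: (iffP (pairwiseP 0)); rewrite !size_drop => H i j.
  move=> ci ij jc; have := H (i - c) (j - c); rewrite !nth_drop ?inE.
  by rewrite !subnKC; [apply | |]; lia.
by rewrite !inE => ic jc ij; rewrite !nth_drop; apply: H; lia.
Qed.

Lemma allrel_splitP (R : rel nat) c (u : seq nat) : c <= size u ->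
  reflect (forall i j, i < c -> c <= j -> j < size u -> R (nth 0 u i) (nth 0 u j))
          (allrel R (take c u) (drop c u)).
Proof.
move=> cu; apply: (iffP allrelP) => H.
  move=> i j ic cj ju; apply: H.
    by rewrite -(nth_take 0 ic) mem_nth // size_take_min /=; lia.
  by rewrite -(subnKC cj) -nth_drop mem_nth // size_drop /=; lia.
move=> x y /(nthP 0)[i]; rewrite size_take_min /= => iu <- /(nthP 0)[j].
by rewrite size_drop /= => ju <-; rewrite nth_drop nth_take; [apply: H|]; lia.
Qed.

Lemma unsafeP w c u : c <= size u ->
  reflect (exists i j, [/\ i < j, j < size u, zone (index 3 w) c i j &
                (nth 0 u i < nth 0 u j) == (index 1 w < index 2 w)])
          (~~ safe w (take c u) (drop c u)).
Proof.
move=> cu; rewrite /safe; set b := index 1 w < index 2 w.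
have nex (Z : nat -> nat -> bool) B :
    reflect (forall i j, i < j -> j < size u -> Z i j -> clear b (nth 0 u i) (nth 0 u j)) B ->
    reflect (exists i j, [/\ i < j, j < size u, Z i j &
                (nth 0 u i < nth 0 u j) == b]) (~~ B).
  move=> BP; apply: (iffP idP) => [|[i [j [ij ju zij e]]]].
    move=> /negP nB.
    case: (boolP [exists i : 'I_(size u), exists j : 'I_(size u),
       [&& i < j, Z i j & (nth 0 u i < nth 0 u j) == b]]).
      by move=> /existsP[i /existsP[j /and3P[*]]]; exists i, j; split.
    rewrite negb_exists => /forallP H; case: nB; apply/BP => i j ij ju zij.
    have iu : i < size u by lia.
    have := H (Ordinal iu); rewrite negb_exists => /forallP/(_ (Ordinal ju)) /=.
    by rewrite ij zij clearE.
  by apply/negP => /BP/(_ i j ij ju zij); rewrite clearE e.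
case: (index 3 w) => [|[|k]] /=; apply: nex.
- apply: (iffP (pairwise_dropP _ _ _)) => H i j *; apply: H => //.
- apply: (iffP (allrel_splitP _ cu)) => H i j.
    by move=> ij ju /andP[ic cj]; apply: H.
  by move=> ic cj ju; apply: H; rewrite ?ic //; lia.
- apply: (iffP (pairwise_takeP _ cu)) => H i j.
    by move=> ij _ jc; apply: H.
  by move=> ij jc; apply: H => //; lia.
Qed.

Definition fits3 (w : seq nat) (x y z : nat) : bool :=
  [&& (x < y) == (nth 0 w 0 < nth 0 w 1), (x < z) == (nth 0 w 0 < nth 0 w 2)
    & (y < z) == (nth 0 w 1 < nth 0 w 2)].

(** A height n above the other two can only match the letter 3. *)
Lemma fits3_top w x y n : w \in patterns3 -> x < n -> y < n ->
  [/\ fits3 w x y n = (index 3 w == 2) && ((x < y) == (index 1 w < index 2 w)),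
      fits3 w x n y = (index 3 w == 1) && ((x < y) == (index 1 w < index 2 w))
    & fits3 w n x y = (index 3 w == 0) && ((x < y) == (index 1 w < index 2 w))].
Proof.
move=> + xn yn; have [nx ny] : (n < x) = false /\ (n < y) = false by split; lia.
rewrite !inE => /or4P[| | |/or3P[]] /eqP->; rewrite /fits3 /= xn yn nx ny /=;
  by rewrite ?eqxx ?andbT ?andbF.
Qed.

Lemma nth_one_line (p : 'S_3) (i : 'I_3) : nth 0 (one_line p) i = (p i).+1.
Proof. by rewrite (nth_map i) ?size_enum_ord // nth_ord_enum. Qed.

(** Since the rows are left-justified, all nine cells of an occurrence
    lie in the board as soon as the three cells of its last column do. *)
Lemma containsP n (ell : nat -> nat) (s : 'S_n) (p : 'S_3) :
  reflect (exists a b d : 'I_n,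
            [/\ a < b, b < d, fits3 (one_line p) (s a) (s b) (s d) &
             [/\ d < ell (s a), d < ell (s b) & d < ell (s d)]])
          (contains (board n ell) s p).
Proof.
pose o0 := @Ordinal 3 0 isT; pose o1 := @Ordinal 3 1 isT; pose o2 := @Ordinal 3 2 isT.
have nthE := nth_one_line p; have E0 := nthE o0; have E1 := nthE o1; have E2 := nthE o2.
rewrite /= in E0 E1 E2.
have Iall (Q : 'I_3 -> Prop) : Q o0 -> Q o1 -> Q o2 -> forall i, Q i.
  move=> q0 q1 q2 [[|[|[|//]]] Hi].
  - by rewrite (_ : Ordinal Hi = o0) //; apply: val_inj.
  - by rewrite (_ : Ordinal Hi = o1) //; apply: val_inj.
  - by rewrite (_ : Ordinal Hi = o2) //; apply: val_inj.
apply: (iffP existsP) => [[f /and3P[finc ford fcell]]|[a [b [d [ab bd fit [la lb ld]]]]]].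
  have inc (i j : 'I_3) : i < j -> f i < f j by move/(implyP (forallP (forallP finc i) j)).
  have ord (i j : 'I_3) : (s (f i) < s (f j)) = (p i < p j)
    by have /forallP/(_ j)/eqP := forallP ford i.
  have cell (i j : 'I_3) : f i < ell (s (f j)) by have := forallP (forallP fcell i) j; rewrite inE.
  exists (f o0), (f o1), (f o2); split; try exact: inc; last by split.
  by rewrite /fits3 E0 E1 E2 !ord !ltnS !eqxx.
pose g (i : 'I_3) := nth a [:: a; b; d] i.
exists (finfun g).
have ad : a < d by apply: ltn_trans bd.
move: fit; rewrite /fits3 E0 E1 E2 !ltnS => /and3P[/eqP e01 /eqP e02 /eqP e12].
have sinj (i j : 'I_n) : i < j -> (s i == s j :> nat) = false.
  by move=> ij; apply/eqP => /val_inj/perm_inj eij; rewrite eij ltnn in ij.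
have pinj (i j : 'I_3) : i < j -> (p i == p j :> nat) = false.
  by move=> ij; apply/eqP => /val_inj/perm_inj eij; rewrite eij ltnn in ij.
have := (sinj _ _ ab, sinj _ _ ad, sinj _ _ bd).
have := (pinj o0 o1 isT, pinj o0 o2 isT, pinj o1 o2 isT).
move=> [[n01 n02] n12] [[m01 m02] m12].
apply/and3P; split; apply/forallP; apply: (Iall _); apply/forallP; apply: (Iall _);
  rewrite ?inE ?ffunE /g /= ?ltnn //; lia.
Qed.

Definition word n (s : 'S_n) : seq nat := [seq (s i : nat) | i <- enum 'I_n].

Lemma size_word n (s : 'S_n) : size (word s) = n.
Proof. by rewrite size_map size_enum_ord. Qed.

Lemma nth_word n (s : 'S_n) (i : 'I_n) : nth 0 (word s) i = s i.
Proof. by rewrite (nth_map i) ?size_enum_ord // nth_ord_enum. Qed.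

Lemma word_inj n : injective (@word n).
Proof.
by move=> s t st; apply/permP => i; apply: val_inj; rewrite /= -!nth_word st.
Qed.

(* The transversal s arises from t by inserting a top row with its 1 in the
   full column c; u lists the heights in the other full columns. *)
Section TopRow.
Variables (n : nat) (ell : nat -> nat) (c : 'I_n.+1) (t : 'S_n).
Hypothesis anti : antitone ell.
Hypothesis ell_le : ell n <= n.+1.
Hypothesis c_lt : c < ell n.

Let s := lift_perm c ord_max t.
Let ell' i := (ell i).-1.
Let u := take (ell n).-1 (word t).

Lemma val_s_lift i : s (lift c i) = t i :> nat.
Proof. by rewrite /s lift_perm_lift /= /bump leqNgt ltn_ord. Qed.

Lemma val_s_c : s c = n :> nat.
Proof. by rewrite /s lift_perm_id. Qed.

Lemma size_u : size u = (ell n).-1.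
Proof. by rewrite size_take_min size_word; lia. Qed.

Lemma nth_u (i : 'I_n) : i < size u -> nth 0 u i = t i.
Proof. by rewrite size_u => iu; rewrite nth_take // nth_word. Qed.

Lemma ell_ge i : i <= n -> c < ell i.
Proof. by move=> /anti; apply: leq_trans. Qed.

(** Removing the full column c shortens every row by one cell. *)
Lemma bump_lt i h : h <= n -> (bump c i < ell h) = (i < ell' h).
Proof. by move=> /ell_ge; rewrite /bump /ell'; lia. Qed.

Lemma lift_lt i j : (lift c i < lift c j) = (i < j).
Proof. by rewrite /= /bump; lia. Qed.

Lemma transversal_lift :
  Defs.transversal (board n.+1 ell) s = Defs.transversal (board n ell') t.
Proof.
apply/forallP/forallP => H i.
  by have := H (lift c i); rewrite !inE /= val_s_lift bump_lt // ltnW.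
rewrite inE /=; case: (unliftP c i) => [j|] -> /=; last by rewrite val_s_c.
by have := H j; rewrite !inE /= val_s_lift bump_lt // ltnW.
Qed.

(** An occurrence in s either avoids the top row, and then it is one in t, or it
    uses the top row, and then it lies in the full columns. *)
Lemma contains_lift (p : 'S_3) :
  contains (board n.+1 ell) s p =
  contains (board n ell') t p || ~~ safe (one_line p) (take c u) (drop c u).
Proof.
have w6 := one_line_mem p; set w := one_line p in w6 *.
have cu : c <= size u by rewrite size_u; lia.
have tn (i : 'I_n) : t i < n by [].
have cases (x : 'I_n.+1) : (exists x' : 'I_n, x = lift c x') \/ x = c.
  by case: (unliftP c x) => [x'|] ->; [left; exists x' | right].
have top i j := fits3_top w6 (tn i) (tn j).
apply/containsP/orP => [[a [b [d [ab bd]]]]|[/containsP|/(unsafeP _ cu)]].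
- rewrite -/w; case: (cases a) ab bd => [[a' ->]|->]; case: (cases b) => [[b' ->]|->];
    case: (cases d) => [[d' ->]|->]; rewrite ?lift_lt ?ltnn ?val_s_lift ?val_s_c //=.
  + move=> ab bd fit [da db dd]; left; apply/containsP; exists a', b', d'.
    by move: da db dd; rewrite !bump_lt ?(ltnW (tn _)) //; split.
  + rewrite /bump => ab bc; case: (top a' b') => -> _ _ /andP[/eqP i3 o] _; right.
    have [ix iy] : a' < size u /\ b' < size u by lia.
    by apply/unsafeP => //; exists a', b'; rewrite !nth_u ?i3 //=; split; lia.
  + move=> ab bc; case: (top a' d') => _ -> _ /andP[/eqP i3 o] [_ dn _]; right.
    move: dn ab bc; rewrite bump_lt // -[ell' n]size_u /bump => dn ab bc.
    have [ix iy] : a' < size u /\ d' < size u by lia.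
    by apply/unsafeP => //; exists a', d'; rewrite !nth_u ?i3 //=; split; lia.
  + move=> ab bc; case: (top b' d') => _ _ -> /andP[/eqP i3 o] [dn _ _]; right.
    move: dn ab bc; rewrite bump_lt // -[ell' n]size_u /bump => dn ab bc.
    have [ix iy] : b' < size u /\ d' < size u by lia.
    by apply/unsafeP => //; exists b', d'; rewrite !nth_u ?i3 //=; split; lia.
  + by rewrite /bump => ab bd; exfalso; lia.
- move=> [a [b [d [ab bd fit [da db dd]]]]].
  exists (lift c a), (lift c b), (lift c d); rewrite !lift_lt !val_s_lift /=.
  by rewrite !bump_lt ?(ltnW (tn _)) //; split.
- move=> [i [j [ij ju z o]]].
  have jn : j < n by move: ju; rewrite size_u; lia.
  have i_n : i < n by lia.
  pose i' := Ordinal i_n; pose j' := Ordinal jn.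
  rewrite (nth_u (i := i')) ?(nth_u (i := j')) //= in o; last by lia.
  have ell_t (h : nat) : h <= n -> ell n <= ell h by exact: anti.
  have [in_ jn_] := (ell_t _ (ltnW (tn i')), ell_t _ (ltnW (tn j'))).
  move: z; case: (top i' j') => t2 t1 t0; rewrite o !andbT in t0 t1 t2.
  rewrite size_u in ju.
  have : index 3 w < 3 by move: (w6); rewrite !inE => /or4P[| | |/or3P[]] /eqP->.
  case: (index 3 w) t0 t1 t2 => [|[|[|//]]] /= t0 t1 t2 _ z.
  + exists c, (lift c i'), (lift c j'); rewrite val_s_c !val_s_lift /= -/w t0.
    by rewrite /bump; split=> //; try split; lia.
  + exists (lift c i'), c, (lift c j'); rewrite val_s_c !val_s_lift /= -/w t1.
    by rewrite /bump; split=> //; try split; lia.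
  + exists (lift c i'), (lift c j'), c; rewrite val_s_c !val_s_lift /= -/w t2.
    by rewrite /bump; split=> //; try split; lia.
Qed.

End TopRow.

(** * Avoiders as words *)

Definition ins (c n : nat) (w : seq nat) : seq nat := take c w ++ n :: drop c w.

Definition allowed (A : seq (seq nat)) (u : seq nat) (c : nat) : bool :=
  all (fun p => safe p (take c u) (drop c u)) A.

Arguments allowed : simpl never.

(** The list rs gives the numbers of full columns of the successive boards, the
    largest board first.  The new maximum [size rs'] goes to one of the r full
    columns, next to the r - 1 other letters in full columns. *)
Fixpoint growth (A : seq (seq nat)) (rs : seq nat) : seq (seq nat) :=
  if rs is r :: rs' then
    [seq ins c (size rs') w | w <- growth A rs',
       c <- [seq c <- iota 0 r | allowed A (take r.-1 w) c]]
  else [:: [::]].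

Fixpoint profile (n : nat) (ell : nat -> nat) : seq nat :=
  if n is m.+1 then ell m :: profile m (fun i => (ell i).-1) else [::].

(** Deleting the top row and a full column leaves at least r - 1 full columns. *)
Fixpoint small_steps (rs : seq nat) : bool :=
  if rs is r :: rs' then (r <= (head 0 rs').+1) && small_steps rs' else true.

Lemma size_profile n ell : size (profile n ell) = n.
Proof. by elim: n ell => //= n IH ell; rewrite IH. Qed.

Lemma profile_small_steps n ell : antitone ell -> ell 0 <= n -> small_steps (profile n ell).
Proof.
elim: n ell => //= n IH ell anti ell0; rewrite IH; last by lia.
  rewrite andbT; case: n ell0 {IH} => [|n] ell0 /=.
    by rewrite (leq_trans _ ell0) ?anti.
  by have := anti n n.+1 (leqnSn n); lia.
by move=> i j /anti; lia.
Qed.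

Lemma small_steps_head r rs : small_steps (r :: rs) -> r <= (size rs).+1.
Proof.
elim: rs r => [|r' rs IH] r /= /andP[rr']; first by move: rr'.
by move/IH; move: rr' => /=; lia.
Qed.

Lemma growthP A r rs w :
  reflect (exists2 v, v \in growth A rs & exists c,
            [/\ c < r, allowed A (take r.-1 v) c & w = ins c (size rs) v])
          (w \in growth A (r :: rs)).
Proof.
apply: (iffP allpairsPdep) => [[v [c [vg]]]|[v vg [c [cr ok ->]]]].
  rewrite mem_filter mem_iota => /andP[ok cr] ->.
  by exists v => //; exists c.
by exists v, c; rewrite mem_filter mem_iota ok.
Qed.

Lemma size_ins c n w : size (ins c n w) = (size w).+1.
Proof. by rewrite size_cat /= addnS -size_cat cat_take_drop. Qed.

Lemma growth_size A rs w : w \in growth A rs ->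
  size w = size rs /\ {in w, forall i, i < size rs}.
Proof.
elim: rs w => [|r rs IH] w; first by rewrite inE => /eqP->.
case/growthP=> v /IH[sv ltv] [c [_ _ ->]]; rewrite size_ins sv; split=> // i.
rewrite mem_cat inE orbCA -mem_cat cat_take_drop => /predU1P[->//|/ltv].
exact: ltnW.
Qed.

Lemma ins_inj c c' n v v' : c <= size v -> c' <= size v' ->
  n \notin v -> n \notin v' -> ins c n v = ins c' n v' -> (c, v) = (c', v').
Proof.
have idx d u : d <= size u -> n \notin u -> index n (ins d n u) = d.
  move=> du nu; rewrite index_cat /= eqxx addn0 size_take_min (minn_idPl du).
  by case: ifP => // /mem_take nu'; rewrite nu' in nu.
have rem d u : d <= size u -> n \notin u -> take d (ins d n u) ++ drop d.+1 (ins d n u) = u.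
  move=> du nu; have sd : size (take d u) = d by rewrite size_take_min (minn_idPl du).
  rewrite /ins take_size_cat // drop_cat sd ltnNge leqnSn /= subSnn drop1.
  by rewrite cat_take_drop.
move=> cv cv' nv nv' e.
have cc : c = c' by rewrite -(idx _ _ cv nv) -(idx _ _ cv' nv') e.
by rewrite -cc in e cv' *; rewrite -(rem _ _ cv nv) -(rem _ _ cv' nv') e.
Qed.

Lemma growth_uniq A rs : small_steps rs -> uniq (growth A rs).
Proof.
elim: rs => //= r rs IH vrs; have /andP[_ /IH urs] := vrs.
apply: allpairs_uniq_dep => // [w _|]; first by rewrite filter_uniq ?iota_uniq.
move=> k k' /allpairsPdep[v [c [vg + ->]]] /allpairsPdep[v' [c' [vg' + ->]]] /=.
rewrite !mem_filter !mem_iota => /andP[_ /= cr] /andP[_ /= cr'] e.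
have rs_r := small_steps_head vrs.
have [sv ltv] := growth_size vg; have [sv' ltv'] := growth_size vg'.
have nin (u : seq nat) : {in u, forall i, i < size rs} -> size rs \notin u.
  by move=> ltu; apply/negP => /ltu; rewrite ltnn.
have cv : c <= size v by rewrite sv; lia.
have cv' : c' <= size v' by rewrite sv'; lia.
by case: (ins_inj cv cv' (nin _ ltv) (nin _ ltv') e) => -> ->.
Qed.

Lemma word_lift n (c : 'I_n.+1) (t : 'S_n) :
  word (lift_perm c ord_max t) = ins c n (word t).
Proof.
apply: (@eq_from_nth _ 0); rewrite ?size_ins !size_word // => i ilt.
rewrite -[i]/(nat_of_ord (Ordinal ilt)) nth_word.
have cn : c <= n by rewrite -ltnS.
rewrite nth_cat size_take_min size_word (minn_idPl cn).
case: (unliftP c (Ordinal ilt)) => [j|] ->; last first.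
  by rewrite lift_perm_id ltnn subnn.
rewrite lift_perm_lift [LHS]/= /bump leqNgt ltn_ord add0n.
rewrite -(nth_word t) (_ : lift c j = bump c j :> nat) // /bump; case: (leqP c j) => cj.
  rewrite add1n ltnNge (leq_trans cj) //= subSn //= nth_drop subnKC //.
by rewrite add0n cj nth_take.
Qed.

Definition pattern_words (P : {set 'S_3}) : seq (seq nat) :=
  [seq w <- patterns3 | w \in [seq one_line p | p in P]].

Lemma mem_pattern_words P p : (one_line p \in pattern_words P) = (p \in P).
Proof.
by rewrite mem_filter one_line_mem andbT mem_map ?mem_enum //; exact: one_line_inj.
Qed.

Lemma all_pattern_words P (a : pred (seq nat)) :
  all a (pattern_words P) = [forall p in P, a (one_line p)].
Proof.
apply/allP/forall_inP => [H p pP|H w]; first by apply: H; rewrite mem_pattern_words.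
by rewrite mem_filter => /andP[/mapP[p pP ->] _]; apply: H; rewrite mem_enum in pP.
Qed.

Lemma avoiders_lift n ell P (c : 'I_n.+1) (t : 'S_n) :
  antitone ell -> ell 0 <= n.+1 -> c < ell n ->
  (lift_perm c ord_max t \in avoiders (board n.+1 ell) P) =
  (t \in avoiders (board n (fun i => (ell i).-1)) P) &&
  allowed (pattern_words P) (take (ell n).-1 (word t)) c.
Proof.
move=> anti ell0 cl; have elln : ell n <= n.+1 by apply: leq_trans ell0; apply: anti.
rewrite !inE transversal_lift // /allowed all_pattern_words -andbA; congr andb.
apply/forall_inP/andP => [H|[/forall_inP H1 /forall_inP H2] p pP].
  split; apply/forall_inP => p /H; rewrite contains_lift // negb_or negbK; by case/andP.
by rewrite contains_lift // negb_or negbK H1 ?H2.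
Qed.

(** Every transversal is obtained from one of the smaller board, by
    reinserting the row and the column of its maximum. *)
Lemma mem_growth n ell P w : antitone ell -> ell 0 <= n ->
  reflect (exists2 s, s \in avoiders (board n ell) P & w = word s)
          (w \in growth (pattern_words P) (profile n ell)).
Proof.
elim: n ell w => [|n IH] ell w anti ell0.
  rewrite inE; apply: (iffP eqP) => [->|[s _ ->]]; last first.
    by apply/eqP; rewrite -size_eq0 size_word.
  exists 1%g; last by apply/esym/eqP; rewrite -size_eq0 size_word.
  rewrite inE; apply/andP; split; first by apply/forallP => -[].
  apply/forall_inP => p _; apply/negP => /containsP[[]] //.
have anti' : antitone (fun i => (ell i).-1) by move=> i j /anti; lia.
have ell'0 : (ell 0).-1 <= n by lia.
have elln : ell n <= n.+1 by apply: leq_trans ell0; apply: anti.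
apply: (iffP (growthP _ _ _ _)); rewrite size_profile.
  case=> v /IH-/(_ anti' ell'0)[t tav ->] [c [cl ok ->]].
  have cn : c < n.+1 by lia.
  exists (lift_perm (Ordinal cn) ord_max t); last by rewrite word_lift.
  by rewrite avoiders_lift // tav ok.
case=> s sav ->; pose c := (s^-1)%g ord_max.
have sc : s c = ord_max by rewrite permKV.
have cl : c < ell n.
  by move: sav; rewrite inE => /andP[/forallP/(_ c)]; rewrite inE sc.
have [t st] : exists t, s = lift_perm c ord_max t.
  have tP i : exists j, s (lift c i) = lift ord_max j.
    case: (unliftP ord_max (s (lift c i))) => [j ->|]; first by exists j.
    by rewrite -sc => /perm_inj/eqP; rewrite eq_sym (negPf (neq_lift _ _)).
  have [f fP] : exists f : 'I_n -> 'I_n, forall i, s (lift c i) = lift ord_max (f i).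
    exists (fun i => odflt i (unlift ord_max (s (lift c i)))) => i.
    by have [j e] := tP i; rewrite e liftK.
  have finj : injective f.
    by move=> i j e; apply: (@lift_inj _ c); apply: (@perm_inj _ s); rewrite !fP e.
  exists (perm finj); apply/permP => i; case: (unliftP c i) => [j|] ->.
    by rewrite lift_perm_lift permE fP.
  by rewrite lift_perm_id.
move: sav; rewrite st avoiders_lift // => /andP[tav ok].
exists (word t); first by apply/IH => //; exists t.
by exists c; rewrite word_lift.
Qed.

Lemma card_avoiders n ell P : antitone ell -> ell 0 <= n ->
  #|avoiders (board n ell) P| = size (growth (pattern_words P) (profile n ell)).
Proof.
move=> anti ell0; rewrite cardE -(size_map (@word n)).
apply/perm_size/uniq_perm.
- by rewrite map_inj_uniq ?enum_uniq //; apply: word_inj.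
- by apply/growth_uniq/profile_small_steps.
- move=> w; apply/mapP/mem_growth => // -[s]; rewrite ?mem_enum => sav ->; exists s => //.
  by rewrite mem_enum.
Qed.

(** * Counting insertions *)

Notation asc := (pairwise (clear false)).
Notation desc := (pairwise (clear true)).

Lemma take_ins r c n w : c <= r -> r <= size w ->
  take r.+1 (ins c n w) = ins c n (take r w).
Proof.
move=> cr rw; rewrite /ins take_cat size_take_min (minn_idPl (leq_trans cr rw)).
rewrite ltnNge (leqW cr) /= subSn //= take_takel //; congr (_ ++ _ :: _).
by rewrite take_drop subnK.
Qed.

Lemma growth0 A rs : growth A (0 :: rs) = [::].
Proof. by rewrite /=; elim: (growth A rs). Qed.

Lemma growth_prefix A r rs w : small_steps (r.+1 :: rs) -> w \in growth A rs ->
  [/\ r <= size w, size (take r w) = r & {in take r w, forall i, i < size rs}].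
Proof.
move=> v /growth_size[sw lw]; have rw : r <= size w by have := small_steps_head v; rewrite sw.
split=> //; first by rewrite size_take_min; apply/minn_idPl.
by move=> i /mem_take/lw.
Qed.

(** A property of words that passes to prefixes and survives permitted insertions
    holds on the full columns of every avoider. *)
Lemma growth_inv A (I : seq nat -> Prop) :
    I [::] -> (forall k u, I u -> I (take k u)) ->
    (forall (u : seq nat) n c, c <= size u -> {in u, forall i, i < n} -> I u -> allowed A u c ->
       I (ins c n u)) ->
  forall r rs w, small_steps (r.+1 :: rs) -> w \in growth A rs -> I (take r w).
Proof.
move=> I0 Itake Iins.
have main rs w : small_steps rs -> w \in growth A rs -> I (take (head 0 rs) w).
  elim: rs w => [|[|r] rs IH] w; rewrite [head _ _]/= ?take0 //.
  move=> v /growthP[w' w'g [c [cr ok ->]]]; have /andP[rh vrs] := v.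
  have [rw sw lw] := growth_prefix v w'g.
  rewrite take_ins //.
  apply: Iins; rewrite ?sw //.
  by rewrite -(@take_takel _ _ (head 0 rs)) //; apply/Itake/IH.
move=> r rs w /= /andP[rh vrs] wg; rewrite -(@take_takel _ _ (head 0 rs)) //.
exact/Itake/main.
Qed.

(** Conditions on a prefix within the full columns can be counted on the full
    columns alone, one insertion at a time. *)
Lemma count_growth A (q : pred (seq nat)) k r rs (E : seq nat -> nat) :
    small_steps (r.+1 :: rs) -> k <= r.+1 ->
    (forall w, w \in growth A rs ->
       count (fun c => allowed A (take r w) c && q (take k (ins c (size rs) (take r w))))
             (iota 0 r.+1) = E w) ->
  count (fun w => q (take k w)) (growth A (r.+1 :: rs)) = \sum_(w <- growth A rs) E w.
Proof.
have growthE r' : growth A (r' :: rs) =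
  [seq ins c (size rs) w | w <- growth A rs,
     c <- [seq c <- iota 0 r' | allowed A (take r'.-1 w) c]] by [].
move=> v kr EP; rewrite growthE count_flatten -map_comp sumnE big_map.
rewrite big_seq [RHS]big_seq; apply: eq_bigr => w wg.
rewrite /comp -EP // count_map count_filter; apply: eq_in_count => c.
rewrite mem_iota add0n => /= cr.
have [rw _ _] := growth_prefix v wg.
rewrite [LHS]/= andbC; congr (_ && q _).
by rewrite -(take_takel _ kr) take_ins.
Qed.

Lemma sum_count (T : Type) (s : seq T) a (p : pred T) :
  \sum_(w <- s) (a * p w) = a * count p s.
Proof. by rewrite -big_distrr -sum1_count; congr (_ * _); rewrite [RHS]big_mkcond. Qed.

Lemma sum_lin (T : Type) (s : seq T) a b (p q : pred T) :
  \sum_(w <- s) (a * p w + b * q w) = a * count p s + b * count q s.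
Proof.
by rewrite big_split /= !sum_count.
Qed.

Lemma count_support (T : eqType) (s t : seq T) (p : pred T) :
  uniq s -> uniq t -> {subset t <= s} -> {in s, forall c, p c -> c \in t} ->
  count p s = count p t.
Proof.
move=> us ut ts st; rewrite -!size_filter; apply/perm_size/uniq_perm; rewrite ?filter_uniq //.
move=> c; rewrite !mem_filter; case pc: (p c) => //=.
by apply/idP/idP => [cs|/ts//]; apply: st.
Qed.

Lemma count_leq_iota a m : count (leq a) (iota 0 m) = m - a.
Proof.
elim: m => [|m IH]; first by [].
by rewrite -addn1 iotaD count_cat IH /= add0n addn0; case: leqP; lia.
Qed.

Section Insertion.
Variables (c k n : nat) (u : seq nat).
Hypotheses (cu : c <= size u) (un : {in u, forall i, i < n}).

Let size_x : size (take c u) = c.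
Proof. by rewrite size_take_min; apply/minn_idPl. Qed.

(** The inserted maximum is followed, within the prefix, by a smaller letter. *)
Lemma asc_ins_over : c < size u -> c.+1 < k -> asc (take k (ins c n u)) = false.
Proof.
move=> cu2 kc; rewrite /ins -cat_rcons take_cat size_rcons size_x ltnNge (ltnW kc) /=.
rewrite (drop_nth 0 cu2).
case: (k - c.+1) (subn_gt0 c.+1 k) => [|j _]; first by rewrite kc.
apply/negP; rewrite /= pairwise_cat => /and3P[/allrelP/(_ n (nth 0 u c))].
rewrite mem_rcons !inE !eqxx => /(_ isT isT); rewrite /clear => nu.
by have := un (mem_nth 0 cu2); rewrite ltnNge (ltnW nu).
Qed.

(** The inserted maximum is preceded by a smaller letter. *)
Lemma desc_ins_over : 0 < c -> c < k -> desc (take k (ins c n u)) = false.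
Proof.
move=> c0 kc; rewrite /ins take_cat size_x ltnNge (ltnW kc) /=.
case: (k - c) (subn_gt0 c k) => [|j _]; first by rewrite kc.
have cu0 : 0 < size u by apply: leq_trans cu.
apply/negP; rewrite /= pairwise_cat => /and3P[/allrelP/(_ (nth 0 u 0) n)].
rewrite -(nth_take 0 c0) mem_nth ?size_x // inE eqxx nth_take // => /(_ isT isT).
by rewrite /clear leqNgt un // mem_nth.
Qed.

Lemma asc_take_ins : asc (take c u) ->
  asc (take k (ins c n u)) = (k <= c.+1) || (c == size u).
Proof.
move=> ax; have axn : asc (rcons (take c u) n).
  rewrite pairwise_rcons ax andbT; apply/allP => i /mem_take/un in_.
  by rewrite /clear.
case: (leqP k c.+1) => kc /=.
  rewrite /ins -cat_rcons takel_cat ?size_rcons ?size_x //.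
  exact: subseq_pairwise (take_subseq _ _) axn.
case: eqVneq => [cu'|cu']; last by rewrite asc_ins_over // ltn_neqAle cu'.
rewrite /ins -cat_rcons [X in drop X u]cu' drop_size cats0.
exact: subseq_pairwise (take_subseq _ _) axn.
Qed.

Lemma desc_take_ins : desc (take c u) -> desc (drop c u) ->
  desc (take k (ins c n u)) = (k <= c) || (c == 0).
Proof.
move=> dx dy; case: (leqP k c) => kc /=.
  by rewrite /ins takel_cat ?size_x //; apply: subseq_pairwise (take_subseq _ _) dx.
have [c0|c0] := posnP c; last exact: desc_ins_over.
have : desc (ins c n u).
  rewrite /ins {1}c0 take0 /= dy andbT; apply/allP => i /mem_drop/un in_.
  by rewrite /clear ltnW.
exact: subseq_pairwise (take_subseq _ _).
Qed.

End Insertion.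

Lemma safe_subseq w x x' y y' : subseq x' x -> subseq y' y -> safe w x y -> safe w x' y'.
Proof.
move=> xx yy; rewrite /safe; case: (index 3 w) => [|[|_]]; try exact: subseq_pairwise.
by move=> /allrelP H; apply/allrelP => i j /(mem_subseq xx) ix /(mem_subseq yy); apply: H.
Qed.

Lemma allowed_take A u c k : allowed A u c -> allowed A (take k u) (minn c k).
Proof.
move=> /allP H; apply/allP => w /H; apply: safe_subseq; case: (leqP c k) => ck.
- by rewrite take_takel.
- by rewrite take_takel // -(take_takel u (ltnW ck)) take_subseq.
- by rewrite -(subnK ck) -take_drop take_subseq.
- by rewrite drop_oversize ?sub0seq // size_take_min geq_minl.
Qed.

(** * Class I *)

Lemma safeE x y :
  (safe w123 x y = desc x) * (safe w213 x y = asc x) *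
  (safe w132 x y = allrel (clear true) x y) * (safe w231 x y = allrel (clear false) x y) *
  (safe w312 x y = desc y) * (safe w321 x y = asc y).
Proof. by []. Qed.

Definition P132_213_231 := [:: w132; w213; w231].
Definition P132_231_321 := [:: w132; w231; w321].
Definition P123_213_312 := [:: w123; w213; w312].
Definition P132_312_321 := [:: w132; w312; w321].

(** The recursion of Class I.  The second argument is the length of the prefix
    on which a shape is prescribed; lengths 0 and 1 mean no condition. *)
Fixpoint phi (rs : seq nat) (k : nat) : nat :=
  if rs is r0 :: rs' then
    if r0 is r.+1 then (k <= 1) * phi rs' 0 + (0 < r) * phi rs' r else 0
  else 1.

Lemma phi_ge2 rs k k' : 1 < k -> 1 < k' -> phi rs k = phi rs k'.
Proof. by case: rs => [|[|r] rs] //=; case: (leqP k 1) => //; case: (leqP k' 1). Qed.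

(** For two of the triples the shape of a prefix of length k at least 2 is
    inherited as it is, instead of being extended to all full columns; both lead
    to the same numbers because [phi] takes a single value on lengths at least 2. *)
Lemma phi_min r rs k : phi (r.+1 :: rs) k =
  (k <= 1) * phi rs 0 + (0 < r) * phi rs (if k <= 1 then r else minn k r).
Proof.
rewrite /=; case: (leqP k 1) => // k1; congr (_ + _).
case: (ltngtP r 1) => [|r1|r1]; [by case: r | |].
  by congr (_ * _); apply: phi_ge2; lia.
by rewrite (minn_idPr _) // r1 ltnW.
Qed.

(** For a triple of Class I at most two positions are permitted, and there is
    only one position when r = 0. *)
Lemma count_two (p : pred nat) r a b :
  a <= r -> (0 < r -> b <= r /\ a != b) ->
  (forall c, c <= r -> c != a -> c != b -> p c = false) ->
  count p (iota 0 r.+1) = p a + (0 < r) * p b.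
Proof.
move=> ar br H; have [r0|r0] := posnP r.
  by move: ar; rewrite r0 leqn0 => /eqP-> /=.
have {br} [br ab] := br r0.
rewrite (@count_support _ _ [:: a; b]) ?iota_uniq //.
- by rewrite /= inE ab.
- by move=> c; rewrite mem_iota add0n ltnS !inE => /orP[] /eqP->.
- move=> c; rewrite mem_iota => /= cr pc; rewrite !inE -[_ || _]negbK negb_or.
  by apply/andP => -[ca cb]; rewrite H in pc.
Qed.

(** Avoiding both 132 and 231 forces the maximum to an end of the full columns. *)
Lemma allrel_both c (u : seq nat) : 0 < c -> c < size u ->
  allrel (clear true) (take c u) (drop c u) ->
  allrel (clear false) (take c u) (drop c u) -> False.
Proof.
move=> c0 cu /(allrel_splitP _ (ltnW cu))/(_ 0 c c0 (leqnn c) cu) ge.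
move=> /(allrel_splitP _ (ltnW cu))/(_ 0 c c0 (leqnn c) cu).
by move: ge; rewrite /clear ltnNge => ->.
Qed.

Lemma asc_ins_last r k n u : size u = r -> {in u, forall i, i < n} ->
  asc (take k (ins r n u)) = asc (take k u).
Proof.
move=> <- un; rewrite /ins take_size drop_size; case: (leqP k (size u)) => ku.
  by rewrite takel_cat.
rewrite take_cat ltnNge (ltnW ku) /= (take_oversize (ltnW ku)).
case: (k - _) (subn_gt0 (size u) k) => [|j _]; first by rewrite ku.
rewrite pairwise_cat /= andbT; case: (asc u); rewrite ?andbF ?andbT //.
by apply/allrelP => i j' /un in_; rewrite inE => /eqP->.
Qed.

Lemma take01 q k (w : seq nat) : k <= 1 -> pairwise q (take k w).
Proof. by case: k => [|[|k]] //; case: w => //= a w; rewrite take0. Qed.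

(** The maximum comes first, with no condition, or last, if the other full
    columns increase. *)
Lemma count_132_213_231 rs k : small_steps rs -> k <= head 0 rs ->
  count (fun w => asc (take k w)) (growth P132_213_231 rs) = phi rs k.
Proof.
elim: rs k => [|[|r] rs IH] k v kr //; first by rewrite growth0.
have /andP[rh vrs] := v.
rewrite [RHS]/= -!IH // -sum_lin; apply: (count_growth v kr) => w wg.
have [_ su un] := growth_prefix v wg; set u := take r w in su un *; set n := size rs in un *.
have [tu du] : take r u = u /\ drop r u = [::] by rewrite -su take_size drop_size.
rewrite (@count_two _ r 0 r) // => [|r0|c cr c0 c1]; last first.
- apply/negbTE/negP; rewrite /allowed /= !safeE => /andP[/and4P[a1 _ a2 _] _].
  apply: (allrel_both _ _ a1 a2); rewrite ?su ?lt0n //.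
  by rewrite ltn_neqAle c1.
- by rewrite neq_ltn r0.
rewrite /allowed /= !safeE /= !tu !du.
rewrite !take0 drop0 asc_take_ins ?take0 // su allrel0l /=.
case: (posnP r) => [r0|r0]; first by rewrite r0 orbT in kr *; rewrite kr.
rewrite !allrel0r /= asc_ins_last // !andbT ltn_eqF // orbF muln1 !mul1n.
by case au: (asc u); rewrite // (subseq_pairwise (take_subseq _ _) au).
Qed.
(** The maximum comes last, with no condition, or first, if the other full
    columns increase. *)
Lemma count_132_231_321 rs k : small_steps rs -> k <= head 0 rs ->
  count (fun w => asc (take k w)) (growth P132_231_321 rs) = phi rs k.
Proof.
elim: rs k => [|[|r] rs IH] k v kr //; first by rewrite growth0.
have /andP[rh vrs] := v.
pose k' := if k <= 1 then r else minn k r.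
have k'r : k' <= r by rewrite /k'; case: ifP => // _; apply: geq_minr.
rewrite phi_min -/k' -!IH ?(leq_trans k'r) // -sum_lin; apply: (count_growth v kr) => w wg.
have [_ su un] := growth_prefix v wg; set u := take r w in su un *; set n := size rs in un *.
have [tu du] : take r u = u /\ drop r u = [::] by rewrite -su take_size drop_size.
rewrite (@count_two _ r 0 r) // => [|r0|c cr c0 c1]; last first.
- apply/negbTE/negP; rewrite /allowed /= !safeE => /andP[/and4P[a1 a2 _ _] _].
  apply: (allrel_both _ _ a1 a2); rewrite ?su ?lt0n //.
  by rewrite ltn_neqAle c1.
- by rewrite neq_ltn r0.
rewrite /allowed /= !safeE /= !tu !du.
rewrite !take0 drop0 asc_take_ins ?take0 // su !allrel0l /=.
rewrite !allrel0r /= asc_ins_last // !andbT.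
case: (posnP r) => [r0|r0].
  by rewrite /k' r0 orbT (_ : k <= 1 = true) ?(size0nil (etrans su r0)) // -r0.
rewrite ltn_eqF // orbF muln1 !mul1n addnC /k'; case: (leqP k 1) => k1.
  by rewrite !(take01 _ _ k1) // andbT.
by rewrite andbF addn0 -take_min.
Qed.

(** At most one letter precedes the maximum and the letters after it decrease,
    so the full columns always decrease from the second one on.  Hence the second
    position is always permitted, and the first one if the others decrease. *)
Lemma count_123_213_312 rs k : small_steps rs -> k <= head 0 rs ->
  count (fun w => desc (take k w)) (growth P123_213_312 rs) = phi rs k.
Proof.
elim: rs k => [|[|r] rs IH] k v kr //; first by rewrite growth0.
have /andP[rh vrs] := v.
rewrite [RHS]/= -!IH // -sum_lin; apply: (count_growth v kr) => w wg.
have inv : desc (behead (take r w)).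
  apply: (growth_inv (I := fun u => desc (behead u)) _ _ _ v wg) => // {w wg}.
    case=> [|k'] [|a u] //= du; exact: subseq_pairwise (take_subseq _ _) du.
  move=> u n c cu un _; rewrite /allowed /= !safeE => /and4P[dx ax dy _].
  have c1 : c <= 1.
    rewrite leqNgt; apply/negP => c1.
    have /(_ 0 1 isT c1) := pairwise_takeP _ cu dx; have /(_ 0 1 isT c1) := pairwise_takeP _ cu ax.
    by rewrite /clear ltnNge => /negbTE->.
  case: c c1 cu {dx ax} dy => [|[|//]] _ cu dy.
    by rewrite drop0 in dy; rewrite /ins take0 drop0.
  case: u un cu dy => //= a u un _; rewrite drop0 => dy; rewrite take0 /= dy andbT.
  by apply/allP => i iu; rewrite /clear ltnW // un // inE iu orbT.
have [_ su un] := growth_prefix v wg; set u := take r w in su un inv *; set n := size rs in un *.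
rewrite (@count_two _ r 0 1) // => [|c cr c0 c1']; last first.
  have c1 : 1 < c by rewrite ltn_neqAle eq_sym c1' lt0n.
  have cu : c <= size u by rewrite su.
  apply/negbTE/negP; rewrite /allowed /= !safeE => /andP[/and4P[dx ax _ _] _].
  have /(_ 0 1 isT c1) := pairwise_takeP _ cu dx; have /(_ 0 1 isT c1) := pairwise_takeP _ cu ax.
  by rewrite /clear ltnNge => /negbTE->.
rewrite /allowed /= !safeE /= !take0 !drop0 /= drop1 inv !(take01 _ u (leqnn 1)) /= !andbT.
case: (posnP r) => [r0|r0]; first by rewrite r0 in kr su *; rewrite (size0nil su) take01 // kr.
have -> : desc (take k (ins 1 n u)) = (k <= 1).
  by rewrite desc_take_ins ?su ?(take01 _ u (leqnn 1)) ?drop1 // orbF.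
rewrite !mul1n muln1 addnC; case du: (desc u) => //=.
by rewrite desc_take_ins ?take0 ?drop0 ?orbT.
Qed.

Lemma nth_ins c n (u : seq nat) i : c <= size u -> nth 0 (ins c n u) i =
  if i < c then nth 0 u i else if i == c then n else nth 0 u i.-1.
Proof.
move=> cu; rewrite nth_cat size_take_min (minn_idPl cu).
case: ltngtP => [ic|ic|->]; last by rewrite subnn.
  by rewrite nth_take.
by case: i ic => // i ic; rewrite subSn //= nth_drop subnKC.
Qed.

(** Avoiding both 312 and 321 leaves at most one full column after the maximum. *)
Lemma asc_desc_drop c (u : seq nat) : desc (drop c u) -> asc (drop c u) -> size u <= c.+1.
Proof.
move=> /pairwise_dropP dy /pairwise_dropP ay; rewrite leqNgt; apply/negP => c1.
have := dy c c.+1 (leqnn c) (ltnSn c) c1; have := ay c c.+1 (leqnn c) (ltnSn c) c1.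
by rewrite /clear ltnNge => /negbTE->.
Qed.

Definition no321 (u : seq nat) : Prop := forall i j l, i < j -> j < l -> l < size u ->
  nth 0 u j <= nth 0 u i -> nth 0 u l <= nth 0 u j -> False.

(** The maximum is inserted last or last but one, so it never starts a descending
    triple, and such a triple without the maximum was there before. *)
Lemma growth_no321 r rs w : small_steps (r.+1 :: rs) -> w \in growth P132_312_321 rs ->
  no321 (take r w).
Proof.
apply: growth_inv => // [j u nu i1 i2 i3 h12 h23|u n c cu un nu].
  rewrite size_take_min => h3.
  by rewrite !nth_take; [apply: nu | | |]; lia.
rewrite /allowed /= !safeE => /and4P[_ dy ay _].
have cs := asc_desc_drop dy ay.
move=> i1 i2 i3 h12 h23; rewrite size_ins => h3; rewrite !nth_ins //.
have nl j : j < size u -> nth 0 u j < n by move=> ju; apply/un/mem_nth.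
have h1c : i1 < c by lia.
rewrite h1c; case: (ltngtP i2 c) => h2c; [|lia|].
  case: (ltngtP i3 c) => h3c; [by apply: nu; lia | by apply: nu; lia|].
  by move=> _; rewrite leqNgt nl //; lia.
by rewrite leqNgt nl //; lia.
Qed.

Definition last_min (v : seq nat) : bool := all (fun a => last 0 v <= a) v.

Lemma last_minP v :
  reflect (forall i, i < (size v).-1 -> nth 0 v (size v).-1 <= nth 0 v i) (last_min v).
Proof.
rewrite /last_min -nth_last; apply: (iffP (all_nthP 0)) => H i iv; first by apply: H; lia.
by case: (ltngtP i (size v).-1) => [|//|->//]; [exact: H | lia].
Qed.

Lemma last_min01 k w : k <= 1 -> last_min (take k w).
Proof.
by case: k => [|[|k]] //; case: w => //= a w _; rewrite take0 /last_min /= leqnn.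
Qed.

Lemma last_min_rcons_max (x : seq nat) n :
  0 < size x -> {in x, forall i, i < n} -> last_min (rcons x n) = false.
Proof.
case: x => // a x _ /(_ a (mem_head _ _)) an; rewrite /last_min last_rcons.
by rewrite all_rcons /= (leqNgt n a) an andbF.
Qed.

(** Otherwise the letters in positions k - 1 and k and the last letter would
    descend. *)
Lemma no321_last_min u k : no321 u -> 1 < k -> k < size u -> last_min (take k u) ->
  last_min u = false.
Proof.
move=> nu k1 ku /last_minP lk; apply/negP => /last_minP lu.
have sk : size (take k u) = k by rewrite size_take_min; apply/minn_idPl/ltnW.
apply: (nu k.-2 k.-1 (size u).-1); try lia; last by apply: lu; lia.
by have := lk k.-2; rewrite sk !nth_take; lia.
Qed.

(** The maximum comes last, with no condition, or last but one, if the last of the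
    other full columns is the lowest of them. *)
Lemma count_132_312_321 rs k : small_steps rs -> k <= head 0 rs ->
  count (fun w => last_min (take k w)) (growth P132_312_321 rs) = phi rs k.
Proof.
elim: rs k => [|[|r] rs IH] k v kr //; first by rewrite growth0.
have /andP[rh vrs] := v.
pose k' := if k <= 1 then r else minn k r.
have k'r : k' <= r by rewrite /k'; case: ifP => // _; apply: geq_minr.
rewrite phi_min -/k' -!IH ?(leq_trans k'r) // -sum_lin; apply: (count_growth v kr) => w wg.
have inv := growth_no321 v wg.
have [_ su un] := growth_prefix v wg.
set u := take r w in su un inv *; set n := size rs in un *.
have [tu du] : take r u = u /\ drop r u = [::] by rewrite -su take_size drop_size.
rewrite (@count_two _ r r r.-1) // => [|r0|c cr c0 c1]; last first.
- apply/negbTE/negP; rewrite /allowed /= !safeE => /andP[/and4P[_ dy ay _] _].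
  by have := asc_desc_drop dy ay; rewrite su; lia.
- by lia.
rewrite /allowed /= !safeE /= !tu !du !allrel0r /= (last_min01 w (leq0n 1)) muln1.
case: (posnP r) => [r0|r0].
  by rewrite r0 in kr *; rewrite kr (last_min01 _ kr).
have [b ub] : exists b, drop r.-1 u = [:: b].
  case: (drop r.-1 u) (size_drop r.-1 u) => [|b [|b' y]]; rewrite su /=; try lia.
  by exists b.
have utb : u = rcons (take r.-1 u) b by rewrite -cats1 -ub cat_take_drop.
have lmu : last_min u = allrel (clear true) (take r.-1 u) [:: b].
  rewrite {1}utb /last_min last_rcons all_rcons leqnn /= /allrel.
  by apply: eq_all => a /=; rewrite andbT.
rewrite ub /= !andbT !mul1n -lmu /k'.
case: (leqP k 1) => k1; first by rewrite !(last_min01 _ k1) andbT.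
have sx : size (take r.-1 u) = r.-1 by rewrite size_take_min su; apply/minn_idPl/leq_pred.
have -> : ins r n u = rcons u n by rewrite /ins tu du cats1.
have -> : ins r.-1 n u = rcons (rcons (take r.-1 u) n) b by rewrite /ins ub -!cats1 -catA.
rewrite add0n take_min -/u.
have xn : {in take r.-1 u, forall i, i < n} by move=> i /mem_take/un.
have bn : b < n by apply: un; rewrite utb mem_rcons inE eqxx.
case: (ltngtP k r) => kr'.
- rewrite -!cats1 -!catA !takel_cat ?su ?sx; [|by lia|by lia].
  rewrite [take k (take r.-1 u)]take_takel; last by lia.
  case lk: (last_min (take k u)); rewrite ?andbF //.
  by rewrite (no321_last_min inv k1) ?su.
- have {kr kr'} -> : k = r.+1 by move: kr => /=; lia.
  have tk (y : seq nat) : size y = r.+1 -> take r.+1 y = y.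
    by move=> sy; rewrite take_oversize ?sy.
  rewrite [take r.+1 u]take_oversize ?su // !tk ?size_rcons ?sx ?su ?(ltn_predK r0) //.
  rewrite last_min_rcons_max ?su // add0n; case lu: (last_min u) => //=.
  move: lu; rewrite {1}utb /last_min !last_rcons !all_rcons => /andP[_ ->].
  by rewrite (ltnW bn) leqnn.
- rewrite kr' [take r (rcons u n)](_ : _ = u); last by rewrite -cats1 take_size_cat.
  rewrite [take r (rcons _ b)](_ : _ = rcons (take r.-1 u) n).
    by rewrite last_min_rcons_max ?sx ?andbF ?addn0 ?[take r u]take_oversize ?su //; lia.
  by rewrite -cats1 take_size_cat ?size_rcons ?sx ?(ltn_predK r0).
Qed.

(** * Classes II and III *)

Definition P123_231_312 := [:: w123; w231; w312].
Definition P132_231_312 := [:: w132; w231; w312].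
Definition P213_231_312 := [:: w213; w231; w312].
Definition P123_132_312 := [:: w123; w132; w312].
Definition P213_231_321 := [:: w213; w231; w321].

(** The recursions of Classes II and III; as for [phi], lengths 0 and 1 of the
    prefix mean the same, whence the maximum with 1. *)
Fixpoint psi (rs : seq nat) (k : nat) : nat :=
  if rs is r0 :: rs' then
    if r0 is r.+1 then 1 * psi rs' r + (maxn k 1 <= r) * psi rs' k else 0
  else 1.

Fixpoint theta (rs : seq nat) (k : nat) : nat :=
  if rs is r0 :: rs' then
    if r0 is r.+1 then (r.+2 - maxn k 1) * theta rs' r else 0
  else 1.

Lemma psiE r rs k : psi (r.+1 :: rs) k = 1 * psi rs r + (maxn k 1 <= r) * psi rs (minn k r).
Proof. by rewrite /=; case: leqP => // kr; rewrite (minn_idPl _) //; lia. Qed.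

(** The maximum comes last, with no condition, or first, if the other full columns
    decrease. *)
Lemma count_132_231_312 rs k : small_steps rs -> k <= head 0 rs ->
  count (fun w => desc (take k w)) (growth P132_231_312 rs) = psi rs k.
Proof.
elim: rs k => [|[|r] rs IH] k v kr //; first by rewrite growth0.
have /andP[rh vrs] := v.
have kr' := geq_minr k r.
rewrite psiE -!IH ?(leq_trans kr') // -sum_lin; apply: (count_growth v kr) => w wg.
have [_ su un] := growth_prefix v wg; rewrite take_min.
set u := take r w in su un *; set n := size rs in un *.
have [tu du] : take r u = u /\ drop r u = [::] by rewrite -su take_size drop_size.
rewrite (@count_two _ r 0 r) // => [|r0|c cr c0 c1]; last first.
- apply/negbTE/negP; rewrite /allowed /= !safeE => /andP[/and4P[a1 a2 _ _] _].
  apply: (allrel_both _ _ a1 a2); rewrite ?su ?lt0n //.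
  by rewrite ltn_neqAle c1.
- by rewrite neq_ltn r0.
rewrite /allowed /= !safeE /= !tu !du take0 drop0 !allrel0l !allrel0r /= andbT mul1n; congr (_ + _).
  by case e: (desc u) => //=; rewrite desc_take_ins ?take0 ?drop0 ?orbT.
case: (posnP r) => [r0|r0]; first by rewrite r0 geq_max ltnn andbF.
rewrite mul1n geq_max r0 andbT; case: (leqP k r) => kr2.
  by rewrite mul1n /ins tu takel_cat ?su.
by rewrite desc_ins_over // su.
Qed.

(** Any position is permitted if the other full columns decrease, and none
    otherwise; only the first position and those from k on keep a decreasing
    prefix of length k. *)
Lemma count_123_132_312 rs k : small_steps rs -> k <= head 0 rs ->
  count (fun w => desc (take k w)) (growth P123_132_312 rs) = theta rs k.
Proof.
elim: rs k => [|[|r] rs IH] k v kr //; first by rewrite growth0.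
have /andP[rh vrs] := v.
rewrite [RHS]/= -IH // -sum_count; apply: (count_growth v kr) => w wg.
have [_ su un] := growth_prefix v wg; set u := take r w in su un *; set n := size rs in un *.
have ok c : allowed P123_132_312 u c = desc u.
  by rewrite -[in RHS](cat_take_drop c u) pairwise_cat /allowed /= !safeE andbT andbCA.
case du: (desc u); last first.
  by rewrite muln0 (@eq_count _ _ pred0) ?count_pred0 // => c; rewrite ok du.
rewrite muln1 -[RHS](_ : (r.+1 - maxn k 1) + 1 = _); last by move: kr => /=; lia.
rewrite -count_leq_iota -[X in _ + X](_ : count (pred1 0) (iota 0 r.+1) = 1).
  rewrite -count_predUI [X in _ + X](@eq_count _ _ pred0) ?count_pred0 ?addn0; last first.
    by move=> c /=; lia.
  apply: eq_in_count => c; rewrite mem_iota add0n => /= cr.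
  rewrite ok du desc_take_ins ?su //=; first by lia.
    exact: subseq_pairwise (take_subseq _ _) du.
  exact: subseq_pairwise (drop_subseq _ _) du.
by rewrite count_uniq_mem ?iota_uniq.
Qed.

(** Any position is permitted if the other full columns increase, and none
    otherwise; exactly the positions from k - 1 on keep an increasing prefix of
    length k. *)
Lemma count_213_231_321 rs k : small_steps rs -> k <= head 0 rs ->
  count (fun w => asc (take k w)) (growth P213_231_321 rs) = theta rs k.
Proof.
elim: rs k => [|[|r] rs IH] k v kr //; first by rewrite growth0.
have /andP[rh vrs] := v.
rewrite [RHS]/= -IH // -sum_count; apply: (count_growth v kr) => w wg.
have [_ su un] := growth_prefix v wg; set u := take r w in su un *; set n := size rs in un *.
have ok c : allowed P213_231_321 u c = asc u.
  by rewrite -[in RHS](cat_take_drop c u) pairwise_cat /allowed /= !safeE andbT andbCA.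
case au: (asc u); last first.
  by rewrite muln0 (@eq_count _ _ pred0) ?count_pred0 // => c; rewrite ok au.
rewrite muln1 -[RHS](_ : r.+1 - k.-1 = _); last by move: kr => /=; lia.
rewrite -count_leq_iota; apply: eq_in_count => c; rewrite mem_iota add0n => /= cr.
rewrite ok au asc_take_ins ?su //=; first by move: kr => /=; lia.
exact: subseq_pairwise (take_subseq _ _) au.
Qed.

(** For these four patterns the inserted maximum can join the letters after the
    cut without spoiling the condition there, so the cut itself stays permitted. *)
Lemma allowed_ins (A : seq (seq nat)) (u : seq nat) n c :
  {subset A <= [:: w123; w213; w231; w312]} ->
  c <= size u -> {in u, forall i, i < n} -> allowed A u c -> allowed A (ins c n u) c.
Proof.
move=> sA cu un /allP ok; have sx : size (take c u) = c by rewrite size_take_min; apply/minn_idPl.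
rewrite /allowed /ins take_size_cat // drop_size_cat //.
apply/allP => w /[dup] /sA + /ok; rewrite !inE => /or4P[] /eqP->; rewrite !safeE //.
  by move=> al; rewrite allrel_consr al andbT; apply/allP => i /mem_take/un in_; rewrite /clear.
by move=> /= ->; rewrite andbT; apply/allP => i /mem_drop/un in_; rewrite /clear ltnW.
Qed.

(** The full columns of an avoider therefore always have a permitted cut: the
    position of the last insertion, or its trace on a prefix. *)
Lemma growth_split (A : seq (seq nat)) r rs w :
  {subset A <= [:: w123; w213; w231; w312]} -> small_steps (r.+1 :: rs) -> w \in growth A rs ->
  exists2 c, c <= r & allowed A (take r w) c.
Proof.
move=> sA v wg; have [_ su _] := growth_prefix v wg.
suff : exists2 c, c <= size (take r w) & allowed A (take r w) c by rewrite su.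
apply: (growth_inv (I := fun u => exists2 c, c <= size u & allowed A u c) _ _ _ v wg).
- exists 0 => //; apply/allP => x /sA; rewrite !inE => /or4P[] /eqP->; by rewrite !safeE.
- move=> k u [c cu ok]; exists (minn c k); last exact: allowed_take.
  by rewrite size_take_min; lia.
- move=> u n c cu un _ ok; exists c; first by rewrite size_ins leqW.
  exact: allowed_ins.
Qed.

Lemma count_single (p : pred nat) (s : seq nat) d :
  uniq s -> d \in s -> {in s, forall c, p c -> c = d} -> count p s = p d.
Proof.
move=> us ds H; rewrite (@count_support _ _ [:: d]) //= ?addn0 //.
  by move=> c; rewrite inE => /eqP->.
by move=> c cs /(H _ cs) ->; rewrite inE.
Qed.

(** The full columns are two decreasing runs, the second one above the first.
    Besides the first position, which needs all of them to decrease, exactly one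
    position is permitted, the end d of the first run, and it keeps a decreasing
    prefix of length k when k is at most d. *)
Lemma count_123_231_312 rs k : small_steps rs -> k <= head 0 rs ->
  count (fun w => desc (take k w)) (growth P123_231_312 rs) = psi rs k.
Proof.
elim: rs k => [|[|r] rs IH] k v kr //; first by rewrite growth0.
have /andP[rh vrs] := v.
have kr' := geq_minr k r.
rewrite psiE -!IH ?(leq_trans kr') // -sum_lin; apply: (count_growth v kr) => w wg.
have [|d0 d0r ok0] := @growth_split P123_231_312 r rs w _ v wg; first by apply/allP.
have [_ su un] := growth_prefix v wg; rewrite take_min.
set u := take r w in su un ok0 *; set n := size rs in un *.
have okE c : allowed P123_231_312 u c =
    [&& desc (take c u), allrel (clear false) (take c u) (drop c u) & desc (drop c u)].
  by rewrite /allowed /= !safeE andbT.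
rewrite -[iota 0 r.+1]/(0 :: iota 1 r) [count _ _]/= mul1n; congr (_ + _).
  rewrite okE take0 drop0 allrel0l /=.
  by case du: (desc u) => //=; rewrite desc_take_ins ?take0 ?drop0 ?orbT.
case: (posnP r) => [r0|r0]; first by rewrite r0 geq_max ltnn andbF.
have [d /andP[d1 dr] okd] : exists2 d, 0 < d <= r & allowed P123_231_312 u d.
  move: ok0; case: d0 d0r => [_|d0 d0r ok]; last by exists d0.+1.
  rewrite okE take0 drop0 => /and3P[_ _ du]; exists r; first by rewrite r0 leqnn.
  by rewrite okE -su take_size drop_size du allrel0r.
have lt_ok c c' : 0 < c -> c < c' -> c' <= r -> allowed P123_231_312 u c ->
    desc (take c' u) -> False.
  move=> c0 cc' c'r; rewrite okE => /and3P[_ + _] dx.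
  have cu : c <= size u by rewrite su; lia.
  have c1 : c.-1 < c by lia.
  move=> /(allrel_splitP _ cu)/(_ _ _ c1 (leqnn c)); rewrite su => /(_ (leq_trans cc' c'r)).
  rewrite -su in c'r; have /(_ _ _ c1 cc') := pairwise_takeP _ c'r dx.
  by rewrite /clear ltnNge => ->.
have desc_ok c : allowed P123_231_312 u c -> desc (take c u) by rewrite okE => /and3P[].
rewrite (@count_single _ _ d) ?iota_uniq ?mem_iota //; last first.
  move=> c; rewrite mem_iota => /andP[c0 cr] /andP[okc _].
  case: (ltngtP c d) => // cd; first by case: (lt_ok c d) => //; apply: desc_ok.
  by case: (lt_ok d c) => //; apply: desc_ok.
  by rewrite d1 add1n.
rewrite /= okd; move: (okd); rewrite okE => /and3P[dx al dy].
rewrite desc_take_ins ?su ?(gtn_eqF d1) ?orbF //=.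
case: (leqP k d) => kd.
  rewrite geq_max (leq_trans kd dr) r0 mul1n.
  by rewrite (subseq_pairwise _ dx) // -(take_takel u kd) take_subseq.
case: leqP => kr2; rewrite ?mul0n // mul1n; apply/esym/eqP; rewrite eqb0.
by apply/negP; apply: (lt_ok d k) => //; move: kr2; rewrite geq_max => /andP[].
Qed.

(** The full columns are an increasing run followed by a decreasing run above it.
    Besides the last position, which needs all of them to increase, exactly one
    position d is permitted, just before the peak, and it keeps an increasing
    prefix of length k when k is at most d + 1. *)
Lemma count_213_231_312 rs k : small_steps rs -> k <= head 0 rs ->
  count (fun w => asc (take k w)) (growth P213_231_312 rs) = psi rs k.
Proof.
elim: rs k => [|[|r] rs IH] k v kr //; first by rewrite growth0.
have /andP[rh vrs] := v.
have kr' := geq_minr k r.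
rewrite psiE -!IH ?(leq_trans kr') // -sum_lin; apply: (count_growth v kr) => w wg.
have [|d0 d0r ok0] := @growth_split P213_231_312 r rs w _ v wg; first by apply/allP.
have [_ su un] := growth_prefix v wg; rewrite take_min.
set u := take r w in su un ok0 *; set n := size rs in un *.
have okE c : allowed P213_231_312 u c =
    [&& asc (take c u), allrel (clear false) (take c u) (drop c u) & desc (drop c u)].
  by rewrite /allowed /= !safeE andbT.
have okr : allowed P213_231_312 u r = asc u.
  by rewrite okE -su take_size drop_size allrel0r andbT.
rewrite -addn1 iotaD count_cat /= add0n addn0 mul1n addnC okr; congr (_ + _).
  by case au: (asc u) => //=; rewrite asc_take_ins ?su ?take_oversize ?su ?eqxx ?orbT.
case: (posnP r) => [r0|r0]; first by rewrite r0 geq_max ltnn andbF.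
have [d dr okd] : exists2 d, d < r & allowed P213_231_312 u d.
  move: (d0r); rewrite leq_eqVlt => /predU1P[d0E|]; last by exists d0.
  exists r.-1; first by lia.
  move: ok0; rewrite d0E okr -{1}(cat_take_drop r.-1 u) pairwise_cat okE => /and3P[-> -> _].
  by apply/pairwise_dropP => i j; rewrite su; lia.
have lt_ok c c' : c < c' -> c' < r -> desc (drop c u) -> nth 0 u c'.-1 < nth 0 u c' -> False.
  move=> cc' c'r /pairwise_dropP dd lt; have [c1 c2] : c <= c'.-1 /\ c'.-1 < c' by lia.
  by have := dd _ _ c1 c2; rewrite su => /(_ c'r); rewrite /clear leqNgt lt.
have last_ok c : 0 < c -> c < r -> allowed P213_231_312 u c -> nth 0 u c.-1 < nth 0 u c.
  move=> c0 cr; rewrite okE => /and3P[_ al _].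
  have cu : c <= size u by rewrite su ltnW.
  by apply: (allrel_splitP _ cu al); rewrite ?su // prednK.
have desc_ok c : allowed P213_231_312 u c -> desc (drop c u) by rewrite okE => /and3P[].
rewrite (@count_single _ _ d) ?iota_uniq ?mem_iota //; last first.
  move=> c; rewrite mem_iota => /= cr /andP[okc _].
  case: (ltngtP c d) => // cd.
    by case: (lt_ok c d) => //; [apply: desc_ok | apply: last_ok => //; apply: leq_ltn_trans cd].
  by case: (lt_ok d c) => //; [apply: desc_ok | apply: last_ok => //; apply: leq_ltn_trans cd].
rewrite /= okd; move: (okd); rewrite okE => /and3P[ax al dy].
have du : d < size u by rewrite su.
rewrite asc_take_ins ?(ltnW du) ?(ltn_eqF du) ?orbF //=.
case: (leqP k d.+1) => kd.
  rewrite geq_max (leq_trans kd dr) r0 mul1n.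
  have -> // : asc (take k u).
  rewrite (subseq_pairwise (_ : subseq _ (take d.+1 u))) //.
    by rewrite -(take_takel u kd) take_subseq.
  rewrite (take_nth 0 du) pairwise_rcons ax andbT; apply/allP => i ix.
  by apply: (allrelP al) => //; rewrite (drop_nth 0 du) mem_head.
case: leqP => kr2; rewrite ?mul0n // mul1n; apply/esym/eqP; rewrite eqb0.
have ku : k <= size u by move: kr2; rewrite geq_max su => /andP[].
apply/negP => /(pairwise_takeP _ ku)/(_ d d.+1 (ltnSn d) kd).
by apply: (lt_ok d d.+1) => //; rewrite -su; apply: leq_trans ku.
Qed.

(** * Reflection in the diagonal *)

Definition transpose n (F : {set 'I_n * 'I_n}) : {set 'I_n * 'I_n} :=
  [set x : 'I_n * 'I_n | (x.2, x.1) \in F].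

Lemma transposeK n : involutive (@transpose n).
Proof. by move=> F; apply/setP => -[c r]; rewrite !inE. Qed.

Lemma transpose_ferrers n (F : {set 'I_n * 'I_n}) :
  ferrers_board F -> ferrers_board (transpose F).
Proof.
case=> left_just bottom_just rows columns; split => [c c' r|c r r'|r|c].
- by rewrite !inE; apply: bottom_just.
- by rewrite !inE; apply: left_just.
- by have [c cF] := columns r; exists c; rewrite inE.
- by have [r rF] := rows c; exists r; rewrite inE.
Qed.

(** The rows of an occurrence, from bottom to top, are the columns of the
    reflected occurrence. *)
Lemma contains_inv n k (F : {set 'I_n * 'I_n}) (s : 'S_n) (p : 'S_k) :
  contains F s p -> contains (transpose F) (s^-1)%g (p^-1)%g.
Proof.
case/existsP=> f /and3P[/'forall_'forall_implyP finc /'forall_'forall_eqP ford /'forall_forallP fF].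
have f_lt i j : (f i < f j) = (i < j).
  case: (ltngtP i j) => [/finc->//|/finc ji|/val_inj->]; last by rewrite ltnn.
  by rewrite ltnNge ltnW.
apply/existsP; exists [ffun i => s (f (p^-1%g i))]; apply/and3P; split;
  apply/'forall_forallP => i j; rewrite !ffunE.
- by apply/implyP; rewrite ford !permKV.
- by rewrite !permK f_lt.
- by rewrite permK inE; apply: fF.
Qed.

Lemma avoiders_inv n k (F : {set 'I_n * 'I_n}) (P : {set 'S_k}) :
  #|avoiders (transpose F) (P^-1)%g| = #|avoiders F P|.
Proof.
have av F' P' s : s \in avoiders F' P' -> (s^-1)%g \in @avoiders n k (transpose F') (P'^-1)%g.
  rewrite !inE => /andP[/forallP sF /forall_inP sP]; apply/andP; split.
    by apply/forallP => c; rewrite inE /=; have := sF (s^-1%g c); rewrite permKV.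
  apply/forall_inP => p; rewrite mem_invg => /sP; apply: contra.
  by move/contains_inv; rewrite invgK transposeK.
rewrite -(card_imset _ (@invg_inj _)); apply: eq_card => s.
apply/imsetP/idP => [[t /av] + ->|sF]; first by rewrite transposeK invgK.
by exists (s^-1)%g; rewrite ?invgK //; apply: av.
Qed.

Lemma wilf_inv k (P Q : {set 'S_k}) :
  shape_wilf_equiv P Q -> shape_wilf_equiv (P^-1)%g (Q^-1)%g.
Proof.
move=> PQ n F /transpose_ferrers/PQ.
by rewrite -(avoiders_inv _ P) -(avoiders_inv _ Q) transposeK.
Qed.

(** * Equivalences between pattern sets *)

Definition pattern_set (A : seq (seq nat)) : {set 'S_3} := [set p | one_line p \in A].

Lemma pattern_words_set A : pattern_words (pattern_set A) = [seq w <- patterns3 | w \in A].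
Proof.
apply: eq_in_filter => w /one_line_surj[p <-].
by rewrite mem_map ?mem_enum ?inE //; apply: one_line_inj.
Qed.

Lemma pattern_wordsK (P : {set 'S_3}) : pattern_set (pattern_words P) = P.
Proof. by apply/setP => p; rewrite inE mem_pattern_words. Qed.

Lemma card_pattern_words (P : {set 'S_3}) : #|P| = size (pattern_words P).
Proof.
rewrite cardE -(size_map (@one_line 3)); apply/perm_size/uniq_perm.
- by rewrite map_inj_uniq ?enum_uniq //; apply: one_line_inj.
- exact: filter_uniq.
- move=> w; rewrite mem_filter; case: (boolP (w \in _)) => //= /mapP[p _ ->].
  by rewrite one_line_mem.
Qed.

Definition word_inv (w : seq nat) : seq nat := [seq (index v w).+1 | v <- [:: 1; 2; 3]].

Lemma size_one_line (p : 'S_3) : size (one_line p) = 3.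
Proof. by rewrite size_map size_enum_ord. Qed.

Lemma one_line_inv (p : 'S_3) : one_line (p^-1)%g = word_inv (one_line p).
Proof.
apply: (@eq_from_nth _ 0); rewrite size_one_line // => i i3.
rewrite -[i]/(nat_of_ord (Ordinal i3)) nth_one_line.
have -> : nth 0 (word_inv (one_line p)) (Ordinal i3) = (index i.+1 (one_line p)).+1.
  by case: i i3 => [|[|[|]]].
congr _.+1; rewrite -[i]/(nat_of_ord (Ordinal i3)) -[in RHS](permKV p (Ordinal i3)).
rewrite /one_line (@index_map _ _ (fun j => (p j : nat).+1)) ?index_enum_ord //.
by move=> j l [/val_inj/perm_inj].
Qed.

Lemma pattern_set_inv A : {subset A <= patterns3} ->
  (pattern_set A)^-1%g = pattern_set (map word_inv A).
Proof.
have invK : {in patterns3, involutive word_inv}.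
  by move=> w; rewrite !inE => /or4P[| | |/or3P[]] /eqP->.
move=> sA; apply/setP => p; rewrite mem_invg !inE one_line_inv.
apply/idP/mapP => [pA|[w wA ->]]; last by rewrite invK ?sA.
by exists (word_inv (one_line p)); rewrite ?invK ?one_line_mem.
Qed.

(** The lists that [pattern_words] can return, on which it is a left inverse of
    [pattern_set]. *)
Definition canonical (A : seq (seq nat)) := [seq w <- patterns3 | w \in A] == A.

Lemma wilf_growth A B : canonical A -> canonical B ->
  (forall rs, small_steps rs -> size (growth A rs) = size (growth B rs)) ->
  shape_wilf_equiv (pattern_set A) (pattern_set B).
Proof.
move=> /eqP cA /eqP cB AB n F /ferrers_boardE->.
have anti := row_len_antitone F; have le_n := row_len_le F 0.
by rewrite !card_avoiders // !pattern_words_set cA cB; apply/AB/profile_small_steps.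
Qed.

Lemma size_count A rs (q : pred (seq nat)) : q [::] ->
  size (growth A rs) = count (fun w => q (take 0 w)) (growth A rs).
Proof. by move=> q0; rewrite (@eq_count _ _ xpredT) ?count_predT // => w; rewrite take0. Qed.

Definition listed_words : seq (seq (seq (seq nat))) :=
  [:: [:: [:: w123; w213; w231]; [:: w123; w213; w312];
          [:: w132; w213; w231]; [:: w132; w213; w312];
          [:: w132; w231; w321]; [:: w132; w312; w321]];
      [:: [:: w123; w231; w312]; [:: w132; w231; w312]; [:: w213; w231; w312]];
      [:: [:: w123; w132; w312]; [:: w213; w231; w321]];
      [:: [:: w123; w132; w231]; [:: w213; w312; w321]];
      [:: [:: w123; w132; w213]]; [:: [:: w123; w132; w321]];
      [:: [:: w123; w213; w321]]; [:: [:: w123; w231; w321]];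
      [:: [:: w123; w312; w321]]; [:: [:: w132; w213; w321]];
      [:: [:: w231; w312; w321]]].

Definition class_of (W : seq (seq (seq nat))) : {set {set 'S_3}} := [set:: map pattern_set W].

Lemma listed_classesE : listed_classes = map class_of listed_words.
Proof.
have one x : [set x] = [set:: [:: x]] :> {set {set 'S_3}} by apply/setP => y; rewrite !inE.
by rewrite /listed_classes /classV /classVI /classVII /classVIII /classIX /classX /classXI !one.
Qed.

Lemma wilf_recursion A B (q q' : pred (seq nat)) (f : seq nat -> nat -> nat) :
    canonical A -> canonical B -> q [::] -> q' [::] ->
    (forall rs k, small_steps rs -> k <= head 0 rs ->
       count (fun w => q (take k w)) (growth A rs) = f rs k) ->
    (forall rs k, small_steps rs -> k <= head 0 rs ->
       count (fun w => q' (take k w)) (growth B rs) = f rs k) ->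
  shape_wilf_equiv (pattern_set A) (pattern_set B).
Proof.
move=> cA cB q0 q'0 HA HB; apply: wilf_growth => // rs vrs.
by rewrite (size_count _ _ q0) (size_count _ _ q'0) HA ?HB.
Qed.

Lemma wilf_sym k (P Q : {set 'S_k}) : shape_wilf_equiv P Q -> shape_wilf_equiv Q P.
Proof. by move=> e n F FF; rewrite e. Qed.

Lemma wilf_trans k (P Q R : {set 'S_k}) :
  shape_wilf_equiv P Q -> shape_wilf_equiv Q R -> shape_wilf_equiv P R.
Proof. by move=> e e' n F FF; rewrite e ?e'. Qed.

Lemma wilf_pattern_set_inv A B A' B' : all (mem patterns3) A -> all (mem patterns3) B ->
    map word_inv A = A' -> map word_inv B = B' ->
  shape_wilf_equiv (pattern_set A) (pattern_set B) ->
  shape_wilf_equiv (pattern_set A') (pattern_set B').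
Proof. by move=> /allP sA /allP sB <- <- /wilf_inv; rewrite !pattern_set_inv. Qed.

(** Each class is connected to its first triple. *)
Lemma wilf_head : {in listed_words, forall W, {in W, forall A,
  shape_wilf_equiv (pattern_set A) (pattern_set (head [::] W))}}.
Proof.
have e12 := @wilf_recursion P132_213_231 P132_231_321 asc asc phi isT isT isT isT
  count_132_213_231 count_132_231_321.
have e13 := @wilf_recursion P132_213_231 P123_213_312 asc desc phi isT isT isT isT
  count_132_213_231 count_123_213_312.
have e14 := @wilf_recursion P132_213_231 P132_312_321 asc last_min phi isT isT isT isT
  count_132_213_231 count_132_312_321.
have e14' := @wilf_pattern_set_inv P132_213_231 P132_231_321
  [:: w132; w213; w312] P132_312_321 isT isT erefl erefl e12.
have e13' := @wilf_pattern_set_inv P132_213_231 P123_213_312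
  [:: w132; w213; w312] [:: w123; w213; w231] isT isT erefl erefl e13.
have f12 := @wilf_recursion P123_231_312 P132_231_312 desc desc psi isT isT isT isT
  count_123_231_312 count_132_231_312.
have f13 := @wilf_recursion P123_231_312 P213_231_312 desc asc psi isT isT isT isT
  count_123_231_312 count_213_231_312.
have g12 := @wilf_recursion P123_132_312 P213_231_321 desc asc theta isT isT isT isT
  count_123_132_312 count_213_231_321.
have g12' := @wilf_pattern_set_inv P123_132_312 P213_231_321
  [:: w123; w132; w231] [:: w213; w312; w321] isT isT erefl erefl g12.
(* The chain passes from counted triples to inverses of counted triples through
   132, 312, 321, which is both counted and the inverse of 132, 231, 321. *)
have e1h := wilf_trans e14 (wilf_trans (wilf_sym e14') e13').
have refl P : @shape_wilf_equiv 3 P P by [].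
have consP (T : eqType) (Q : T -> Prop) y s :
    Q y -> {in s, forall x, Q x} -> {in y :: s, forall x, Q x}.
  by move=> Qy Qs x; rewrite inE => /predU1P[->//|/Qs].
have nilP (T : eqType) (Q : T -> Prop) : {in [::], forall x, Q x} by [].
rewrite /listed_words.
apply: (consP).
  rewrite [head _ _]/=; apply: (consP); first exact: refl.
  apply: (consP); first exact: wilf_trans (wilf_sym e13) e1h.
  apply: (consP); first exact: e1h.
  apply: (consP); first exact: e13'.
  apply: (consP); first exact: wilf_trans (wilf_sym e12) e1h.
  apply: (consP); first exact: wilf_trans (wilf_sym e14) e1h.
  exact: nilP.
apply: (consP).
  rewrite [head _ _]/=; apply: (consP); first exact: refl.
  apply: (consP); first exact: wilf_sym f12.
  apply: (consP); first exact: wilf_sym f13.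
  exact: nilP.
apply: (consP).
  rewrite [head _ _]/=; apply: (consP); first exact: refl.
  apply: (consP); first exact: wilf_sym g12.
  exact: nilP.
apply: (consP).
  rewrite [head _ _]/=; apply: (consP); first exact: refl.
  apply: (consP); first exact: wilf_sym g12'.
  exact: nilP.
do 7! [apply: (consP); first by apply: (consP); [exact: refl | exact: nilP]].
exact: nilP.
Qed.

Lemma same_class W A B : W \in listed_words -> A \in W -> B \in W ->
  shape_wilf_equiv (pattern_set A) (pattern_set B).
Proof.
move=> WL AW BW.
exact: wilf_trans (wilf_head WL AW) (wilf_sym (wilf_head WL BW)).
Qed.

(** * The classification *)

Lemma pattern_words_listed (P : {set 'S_3}) : #|P| = 3 -> pattern_words P \in flatten listed_words.
Proof.
rewrite card_pattern_words /pattern_words filter_mask.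
by rewrite /patterns3 /=; do 6 case: (_ \in _).
Qed.

Lemma listed_canonical A : A \in flatten listed_words -> canonical A && (size A == 3).
Proof. by apply/allP: A; vm_compute. Qed.

Lemma pattern_setK A : A \in flatten listed_words -> pattern_words (pattern_set A) = A.
Proof. by move=> /listed_canonical/andP[/eqP cA _]; rewrite pattern_words_set. Qed.

Lemma mem_class_of W P : W \in listed_words -> (P \in class_of W) = (pattern_words P \in W).
Proof.
move=> WL; rewrite inE; apply/mapP/idP => [[A AW ->]|PW]; last first.
  by exists (pattern_words P); rewrite ?pattern_wordsK.
by rewrite pattern_setK //; apply/flattenP; exists W.
Qed.

Lemma listed_words_disjoint W W' A : W \in listed_words -> W' \in listed_words ->
  A \in W -> A \in W' -> W = W'.
Proof.
have H : all (fun W => all (fun W' => has (mem W') W ==> (W == W')) listed_words) listed_words.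
  by vm_compute.
move=> /(allP H)/allP{H}H /H/implyP{}H AW AW'.
by apply/eqP/H/hasP; exists A.
Qed.

(** Row lengths, from bottom to top, of two boards with five rows. *)
Definition test_boards : seq (seq nat) := [:: [:: 5; 5; 5; 4; 3]; [:: 5; 5; 5; 4; 4]].

Definition signature (A : seq (seq nat)) : seq nat :=
  [seq size (growth A (profile 5 (nth 0 b))) | b <- test_boards].

Lemma signature_wilf P Q :
  shape_wilf_equiv P Q -> signature (pattern_words P) = signature (pattern_words Q).
Proof.
move=> PQ; apply/eq_in_map => b bT.
have anti : antitone (nth 0 b).
  have sb : sorted geq b by move: b bT; apply/allP.
  move=> i j ij; case: (ltnP j (size b)) => jb; last by rewrite nth_default.
  apply: (sorted_leq_nth _ _ _ sb); rewrite ?inE //.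
  - by move=> x y z /= xy /leq_trans; apply.
  - exact: leqnn.
  - exact: leq_ltn_trans jb.
have /andP[b0 b4] : (nth 0 b 0 == 5) && (0 < nth 0 b 4) by move: b bT {anti}; apply/allP.
rewrite -!card_avoiders ?(eqP b0) //; apply/PQ/board_ferrers => //.
by rewrite (eqP b0).
Qed.

(** The two boards separate all classes; this is a computation with [growth] over
    the 20 triples. *)
Lemma signature_class A B : A \in flatten listed_words -> B \in flatten listed_words ->
  signature A = signature B -> exists2 W, W \in listed_words & (A \in W) && (B \in W).
Proof.
have H : all (fun A => all (fun B => (signature A == signature B) ==>
    has (fun W => (A \in W) && (B \in W)) listed_words)
    (flatten listed_words)) (flatten listed_words) by vm_compute.
move=> /(allP H)/allP{H}H /H/implyP{}H /eqP/H/hasP[W WL AB].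
by exists W.
Qed.

Lemma wilf_classes (P Q : {set 'S_3}) : #|P| = 3 -> #|Q| = 3 ->
  shape_wilf_equiv P Q <-> exists2 W, W \in listed_words &
    (pattern_words P \in W) && (pattern_words Q \in W).
Proof.
move=> P3 Q3; split => [/signature_wilf|[W WL /andP[PW QW]]].
  by apply: signature_class; apply: pattern_words_listed.
by rewrite -(pattern_wordsK P) -(pattern_wordsK Q); apply: same_class PW QW.
Qed.

Lemma card_listed W P : W \in listed_words -> pattern_words P \in W -> #|P| = 3.
Proof.
move=> WL PW; rewrite card_pattern_words.
have /listed_canonical/andP[_ /eqP//] : pattern_words P \in flatten listed_words.
by apply/flattenP; exists W.
Qed.

Lemma class_of_wilf W P : W \in listed_words -> pattern_words P \in W -> forall Q,
  Q \in class_of W <-> #|Q| = 3 /\ shape_wilf_equiv P Q.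
Proof.
move=> WL PW Q; have P3 := card_listed WL PW; rewrite mem_class_of //; split=> [QW|[Q3]].
  have Q3 := card_listed WL QW; split=> //.
  by apply/wilf_classes => //; exists W; rewrite ?PW.
move=> /(wilf_classes P3 Q3)[W' W'L /andP[PW' QW']].
by rewrite (listed_words_disjoint WL W'L PW PW').
Qed.

Lemma listed_classes_uniq : uniq listed_classes.
Proof.
rewrite listed_classesE map_inj_in_uniq; first by vm_compute.
move=> W W' WL W'L e.
have [A AW] : exists A, A \in W.
  have : 0 < size W by move: W WL {e}; apply/allP.
  by case: W WL e => // A W _ _ _; exists A; rewrite mem_head.
have AL : A \in flatten listed_words by apply/flattenP; exists W.
apply: (@listed_words_disjoint _ _ A) => //.
by rewrite -{1}(pattern_setK AL) -mem_class_of // -e mem_class_of ?pattern_setK.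
Qed.

Theorem mainTheorem1 :
  [/\ #|[set P : {set 'S_3} | #|P| == 3]| = 20,
      (exists K : {set {set {set 'S_3}}},
         #|K| = 11 /\
         forall C : {set {set 'S_3}}, C \in K <-> shape_wilf_class C)
    & forall P Q : {set 'S_3}, #|P| = 3 -> #|Q| = 3 ->
        (shape_wilf_equiv P Q <->
         exists2 C : {set {set 'S_3}},
           C \in listed_classes & (P \in C) && (Q \in C))].
Proof.
split.
- have -> : 20 = 'C(#|{: 'S_3}|, 3) by rewrite card_Sn.
  by rewrite -card_draws; apply: eq_card => P; rewrite !inE.
- exists [set:: listed_classes]; split.
    by rewrite cardsE (card_uniqP listed_classes_uniq).
  move=> C; rewrite inE listed_classesE; split=> [/mapP[W WL ->]|[P P3 CP]].
    have [A AW] : exists A, A \in W.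
      have : 0 < size W by move: W WL; apply/allP.
      by case: W WL => // A W _ _; exists A; rewrite mem_head.
    have cA : pattern_words (pattern_set A) = A by apply/pattern_setK/flattenP; exists W.
    exists (pattern_set A); first by apply: (card_listed WL); rewrite cA.
    by apply: class_of_wilf; rewrite ?cA.
  have /flattenP[W WL PW] := pattern_words_listed P3.
  apply/mapP; exists W => //; apply/setP => Q; apply/idP/idP.
    by move/CP/(class_of_wilf WL PW).
  by move/(class_of_wilf WL PW)/CP.
- move=> P Q P3 Q3; rewrite wilf_classes // listed_classesE; split.
    move=> [W WL PQ]; exists (class_of W); first exact: map_f.
    by rewrite !mem_class_of.
  by move=> [_ /mapP[W WL ->]]; rewrite !mem_class_of //; exists W.
Qed.
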